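(* For a real Banach lattice $E$ the following statements are equivalent. (1) $E$ has the (d)-DP property. (2) $E$ has the Dunford-Pettis property and every order interval of $E$ is a Dunford-Pettis set. (3) Every weakly compact operator from $E$ into an arbitrary Banach space is a DW-compact operator. (4) Every weakly compact operator from $E$ into $c_0$ is a DW-compact operator.
   Context: Operators are bounded and linear. For $A\subset E$, $Sol(A)=\{y\in E: |y|\le |x| \text{ for some } x\in A\}$. A bounded subset $A$ of $E$ is disjointly weakly compact if every disjoint sequence in $Sol(A)$ converges weakly to zero. A bounded linear operator $T$ from $E$ to a Banach space is DW-compact if $T(A)$ is relatively (norm) compact for each disjointly weakly compact $A\subset E$. A bounded subset $A$ of a Banach space $X$ is a Dunford-Pettis set if every weakly null sequence $(f_n)\subset X^\prime$ converges uniformly to zero on $A$, i.e. $\sup_{x\in A}|f_n(x)|\to 0$. $X$ has the Dunford-Pettis property if every relatively weakly compact set in $X$ is a Dunford-Pettis set. $E$ has the (d)-DP property if every disjointly weakly compact subset of $E$ is a Dunford-Pettis set. *)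

(* Defs.v *)
From HB Require Import structures.
From mathcomp Require Import all_boot all_order all_algebra.
From mathcomp Require Import all_classical all_reals all_analysis.
Import Order.TTheory GRing.Theory Num.Theory.
Import numFieldNormedType.Exports.

Set Implicit Arguments.
Unset Strict Implicit.
Unset Printing Implicit Defensive.

Local Open Scope classical_set_scope.
Local Open Scope ring_scope.

(* The order is a field of the mixin because Hierarchy Builder rejects a join
   of CompleteNormedModule and Order.Lattice (Num.RealDomain would need it as
   an ancestor).  Below, [vlattice E] is E seen as a latticeType.
   [`|x|] always denotes the norm; the absolute value is [labs x]. *)
HB.mixin Record isBanachLattice (R : realType) E & CompleteNormedModule R E := {
  lle : rel E ;
  ljoin : E -> E -> E ;
  lmeet : E -> E -> E ;
  lle_refl : reflexive lle ;
  lle_anti : antisymmetric lle ;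
  lle_trans : transitive lle ;
  lleUx : forall x y z, lle (ljoin x y) z = lle x z && lle y z ;
  llexI : forall x y z, lle x (lmeet y z) = lle x y && lle x z ;
  lleD2r : forall z x y, lle x y -> lle (x + z) (y + z) ;
  lscale_ge0 : forall (a : R) x, 0 <= a -> lle 0 x -> lle 0 (a *: x) ;
  lnorm_le : forall x y,
    lle (ljoin x (- x)) (ljoin y (- y)) -> `|x| <= `|y|
}.

#[short(type="banachLatticeType")]
HB.structure Definition BanachLattice (R : realType) :=
  {E of CompleteNormedModule R E & isBanachLattice R E}.

Definition labs {R : realType} {E : banachLatticeType R} (x : E) : E :=
  ljoin x (- x).

Definition vlattice {R : realType} (E : banachLatticeType R) : Type := E.

Fact vlattice_display : Order.disp_t. Proof. exact: Order.default_display. Qed.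

Section vlattice.
Context {R : realType} {E : banachLatticeType R}.

HB.instance Definition _ := Choice.copy (vlattice E) E.

HB.instance Definition _ := Order.Le_isPOrder.Build vlattice_display
  (vlattice E) (@lle_refl R E) (@lle_anti R E) (@lle_trans R E).

HB.instance Definition _ := Order.POrder_isJoinSemilattice.Build
  vlattice_display (vlattice E) (@lleUx R E).

HB.instance Definition _ := Order.POrder_isMeetSemilattice.Build
  vlattice_display (vlattice E) (@llexI R E).

End vlattice.

Section dual_pred.
Context {R : realType} {X : normedModType R}.

Definition dual_pred : {pred X -> R} :=
  mem [set f : X -> R | linear f /\ bounded_fun_norm f].

Lemma dual_predP (f : X -> R) :
  reflect (linear f /\ bounded_fun_norm f) (f \in dual_pred).
Proof. by apply: (iffP idP); rewrite inE. Qed.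

Lemma dual_submod_closed : GRing.subsemimod_closed dual_pred.
Proof.
split; first split.
- apply/dual_predP; split=> [a x y|r]; first by rewrite scaler0 addr0.
  by exists 0 => x _; rewrite normr0.
- move=> f g /dual_predP[lf bf] /dual_predP[lg bg]; apply/dual_predP; split.
    by move=> b x y; rewrite !fctE lf lg scalerDr addrACA.
  move=> r; have [M Mf] := bf r; have [N Ng] := bg r.
  exists (M + N) => x xr; rewrite !fctE.
  by rewrite (le_trans (ler_normD _ _))// lerD ?Ng ?Mf.
move=> a f /dual_predP[lf bf]; apply/dual_predP; split.
  by move=> b x y; rewrite !fctE lf scalerDr !scalerA mulrC.
move=> r; have [M Mf] := bf r; exists (`|a| * M) => x xr; rewrite !fctE.
by rewrite normrZ ler_wpM2l// Mf.
Qed.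

HB.instance Definition _ :=
  GRing.isSubmodClosed.Build R (X -> R) dual_pred dual_submod_closed.

End dual_pred.

(* The Banach dual X', normed by the operator norm [dual_norm]; its own dual
   [dual_space (dual_space X)] is what defines weakly null sequences in X'. *)
Record dual_space (R : realType) (X : normedModType R) := Dual {
  dual_fun :> X -> R ;
  dual_funP : dual_fun \in dual_pred }.

Section dual_space.
Context {R : realType} {X : normedModType R}.

HB.instance Definition _ := [isSub of dual_space X for @dual_fun R X].
HB.instance Definition _ := [Choice of dual_space X by <:].
HB.instance Definition _ := [SubChoice_isSubLmodule of dual_space X by <:].

Definition dual_norm (f : dual_space X) : R :=
  sup [set `|f x| | x in [set x | `|x| <= 1]].

Let dual_norm_has_sup (f : dual_space X) :
  has_sup [set `|f x| | x in [set x | `|x| <= 1]].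
Proof.
split; first by exists `|f 0|, 0 => //=; rewrite normr0.
have [_ /(_ 1)[M fM]] := dual_predP _ (dual_funP f).
by exists M => _ [x x1 <-]; exact: fM.
Qed.

Lemma dual_linear (f : dual_space X) : linear f.
Proof. by have [] := dual_predP _ (dual_funP f). Qed.

Lemma dual_norm_ub (f : dual_space X) x : `|x| <= 1 -> `|f x| <= dual_norm f.
Proof.
by move=> x1; apply: sup_upper_bound; [exact: dual_norm_has_sup|exists x].
Qed.

Lemma dual_norm_le (f : dual_space X) M :
  (forall x, `|x| <= 1 -> `|f x| <= M) -> dual_norm f <= M.
Proof.
move=> fM; apply: ge_sup; first by case: (dual_norm_has_sup f).
by move=> _ [x x1 <-]; exact: fM.
Qed.

Let dual_normD (f g : dual_space X) : dual_norm (f + g) <= dual_norm f + dual_norm g.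
Proof.
apply: dual_norm_le => x x1 /=.
by rewrite (le_trans (ler_normD _ _))// lerD// dual_norm_ub.
Qed.

Let dual_norm_ge0 (f : dual_space X) : 0 <= dual_norm f.
Proof.
by apply: le_trans (dual_norm_ub f (x := 0) _) => //; rewrite normr0.
Qed.

Let dual_normZ_le (a : R) (f : dual_space X) : dual_norm (a *: f) <= `|a| * dual_norm f.
Proof.
by apply: dual_norm_le => x x1 /=; rewrite normrM ler_wpM2l// dual_norm_ub.
Qed.

Let dual_normZ (a : R) (f : dual_space X) : dual_norm (a *: f) = `|a| * dual_norm f.
Proof.
apply/eqP; rewrite eq_le dual_normZ_le/=.
have [->|a0] := eqVneq a 0; first by rewrite normr0 mul0r.
rewrite -ler_pdivlMl ?normr_gt0// -normfV.
by rewrite -[in leLHS](scalerK a0 f).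
Qed.

Let dual_norm0_eq0 (f : dual_space X) : dual_norm f = 0 -> f = 0.
Proof.
move=> f0; apply/val_inj/funext => x /=; apply/eqP.
have f0x : f 0 = 0.
  have := dual_linear f 1 0 0; rewrite !scale1r addr0 => h.
  by apply: (@addrI _ (f 0)); rewrite addr0 -h.
have fZ (a : R) : f (a *: x) = a * f x.
  by have := dual_linear f a x 0; rewrite f0x !addr0.
have [->|x0] := eqVneq x 0; first by rewrite f0x.
have := dual_norm_ub f (x := `|x|^-1 *: x).
rewrite normfZV// => /(_ (lexx _)); rewrite f0 normr_le0 fZ mulf_eq0.
by rewrite invr_eq0 normr_eq0 (negbTE x0).
Qed.

HB.instance Definition _ := Lmodule_isNormed.Build R (dual_space X)
  dual_normD dual_normZ dual_norm0_eq0.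

End dual_space.

Section c0_pred.
Context {R : realType}.

Definition c0_pred : {pred nat -> R} := mem [set u : nat -> R | u @ \oo --> 0].

Lemma c0_predP (u : nat -> R) : reflect (u @ \oo --> 0) (u \in c0_pred).
Proof. by apply: (iffP idP); rewrite inE. Qed.

Lemma c0_submod_closed : GRing.subsemimod_closed c0_pred.
Proof.
split; first split.
- by apply/c0_predP; exact: cvg_cst.
- move=> u v /c0_predP u0 /c0_predP v0; apply/c0_predP.
  by rewrite -[0]addr0; exact: cvgD.
by move=> a u /c0_predP u0; apply/c0_predP; rewrite -(mulr0 a); exact: cvgMr.
Qed.

HB.instance Definition _ :=
  GRing.isSubmodClosed.Build R (nat -> R) c0_pred c0_submod_closed.

End c0_pred.

Record c0 (R : realType) := C0 {
  c0_fun :> nat -> R ;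
  c0_funP : c0_fun \in c0_pred }.

Section c0.
Context {R : realType}.

HB.instance Definition _ := [isSub of c0 R for @c0_fun R].
HB.instance Definition _ := [Choice of c0 R by <:].
HB.instance Definition _ := [SubChoice_isSubLmodule of c0 R by <:].

Definition c0_norm (u : c0 R) : R := sup (range (fun n => `|u n|)).

Lemma c0_cvg (u : c0 R) : u @ \oo --> (0 : R).
Proof. exact/c0_predP/c0_funP. Qed.

Let c0_norm_has_sup (u : c0 R) : has_sup (range (fun n => `|u n|)).
Proof.
split; first by exists `|u 0%N|, 0%N.
have /cvg_seq_bounded := cvgP _ (c0_cvg u).
by move=> /pinfty_ex_gt0[M _ uM]; exists M => _ [n _ <-]; exact: uM.
Qed.

Lemma c0_norm_ub (u : c0 R) n : `|u n| <= c0_norm u.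
Proof. by apply: sup_upper_bound; [exact: c0_norm_has_sup|exists n]. Qed.

Lemma c0_norm_le (u : c0 R) M : (forall n, `|u n| <= M) -> c0_norm u <= M.
Proof.
move=> uM; apply: ge_sup; first by case: (c0_norm_has_sup u).
by move=> _ [n _ <-].
Qed.

Let c0_normD (u v : c0 R) : c0_norm (u + v) <= c0_norm u + c0_norm v.
Proof.
apply: c0_norm_le => n /=.
by rewrite (le_trans (ler_normD _ _))// lerD// c0_norm_ub.
Qed.

Let c0_normZ_le (a : R) (u : c0 R) : c0_norm (a *: u) <= `|a| * c0_norm u.
Proof.
by apply: c0_norm_le => n /=; rewrite normrM ler_wpM2l// c0_norm_ub.
Qed.

Let c0_normZ (a : R) (u : c0 R) : c0_norm (a *: u) = `|a| * c0_norm u.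
Proof.
apply/eqP; rewrite eq_le c0_normZ_le/=.
have [->|a0] := eqVneq a 0.
  by rewrite normr0 mul0r (le_trans _ (c0_norm_ub _ 0))// normr_ge0.
rewrite -ler_pdivlMl ?normr_gt0// -normfV.
by rewrite -[in leLHS](scalerK a0 u).
Qed.

Let c0_norm0_eq0 (u : c0 R) : c0_norm u = 0 -> u = 0.
Proof.
move=> u0; apply/val_inj/funext => n /=; apply/eqP.
by rewrite -normr_le0 -u0 c0_norm_ub.
Qed.

HB.instance Definition _ := Lmodule_isNormed.Build R (c0 R)
  c0_normD c0_normZ c0_norm0_eq0.

Let c0_complete (F : set_system (c0 R)) :
  ProperFilter F -> cauchy F -> cvg F.
Proof.
move=> FF /cauchyP Fc.
have ler_coord (u v : c0 R) n : `|u n - v n| <= `|u - v|.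
  exact: (c0_norm_ub (u - v) n).
have Fn n : cvg ((fun u : c0 R => u n) @ F).
  apply: R_complete; apply/cauchyP => e e0; have [u Fu] := Fc _ e0.
  exists (u n); rewrite /= /fmap/=; apply: filterS Fu => v.
  rewrite -!ball_normE /=; exact: le_lt_trans.
pose l n := lim ((fun u : c0 R => u n) @ F).
have lP (e : R) : 0 < e -> F [set u : c0 R | forall n, `|u n - l n| <= e].
  move=> e0; have e20 : 0 < e / 2 by rewrite divr_gt0.
  have [u] := Fc _ e20; rewrite -ball_normE => Fu.
  apply: (filterS _ Fu) => v /= uv n.
  rewrite (splitr e) -(subrKA (u n)) (le_trans (ler_normD _ _))// lerD//.
    by rewrite distrC (le_trans (ler_coord _ _ _))// ltW.
  have unl : (fun w : c0 R => `|u n - w n|) @ F --> `|u n - l n|.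
    by apply: cvg_norm; apply: cvgB; [exact: cvg_cst|exact: Fn].
  apply: (cvgr_to_le unl); apply: (filterS _ Fu) => w.
  by move=> /= /ltW; exact: le_trans (ler_coord _ _ _).
have l0 : l \in c0_pred.
  apply/c0_predP/cvgr0Pnorm_le => e e0.
  have e20 : 0 < e / 2 by rewrite divr_gt0.
  near F => u.
  have ul : forall n, `|u n - l n| <= e / 2 by near: u; exact: lP.
  have /cvgr0Pnorm_le/(_ _ e20) := c0_cvg u.
  apply: filterS => n un; rewrite -(subKr (u n) (l n)) (splitr e).
  by rewrite (le_trans (ler_normB _ _))// lerD.
apply/cvg_ex; exists (C0 l0); apply/cvgrPdist_le => e e0.
apply: filterS (lP _ e0) => u ul.
by rewrite distrC; apply: c0_norm_le => n; exact: ul.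
Unshelve. all: by end_near. Qed.

HB.instance Definition _ := Uniform_isComplete.Build (c0 R) c0_complete.

End c0.

(* The weak topology is the initial topology for the evaluation map of X into
   the product of the scalar fields indexed by X'. *)
Definition dual_eval (R : realType) (X : normedModType R) (x : X) :
  {ptws dual_space X -> R} := fun f => f x.

Definition weak_space (R : realType) (X : normedModType R) : Type :=
  initial_topology (@dual_eval R X).

HB.instance Definition _ (R : realType) (X : normedModType R) :=
  Topological.copy (weak_space X) (initial_topology (@dual_eval R X)).

Lemma weak_cvgP (R : realType) (X : normedModType R) (F : set_system X)
    (x : X) : Filter F ->
  F --> (x : weak_space X) <-> forall f : dual_space X, f y @[y --> F] --> f x.
Proof.
move=> FF; split=> [Fx f|Fx].
  have ev : dual_eval y @[y --> F] --> dual_eval x.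
    by move=> B /(initial_continuous (x := x : weak_space X)) /Fx.
  by move/pointwise_cvgP : ev; exact.
have ev : dual_eval y @[y --> F] --> dual_eval x.
  exact/pointwise_cvgP.
move=> A [_ [[B oB <-]] /= Bx BA].
apply: (filterS BA); apply: ev.
exact: open_nbhs_nbhs.
Qed.

Definition weakly_null (R : realType) (X : normedModType R) (u : nat -> X) :
    Prop :=
  u @ \oo --> (0 : weak_space X).

Section weak_notions.
Context {R : realType} {X : normedModType R}.

Definition relatively_weakly_compact (A : set X) : Prop :=
  precompact (A : set (weak_space X)).

Definition dunford_pettis_set (A : set X) : Prop :=
  bounded_set A /\
  forall f : nat -> dual_space X, weakly_null f ->
    sup [set `|f n x| | x in A] @[n --> \oo] --> (0 : R).

End weak_notions.

Definition dunford_pettis_property (R : realType) (X : normedModType R) :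
    Prop :=
  forall A : set X, relatively_weakly_compact A -> dunford_pettis_set A.

Definition weakly_compact_operator (R : realType) (X Y : normedModType R)
    (T : {linear X -> Y}) : Prop :=
  bounded_fun_norm T /\
  forall A : set X, bounded_set A -> relatively_weakly_compact (T @` A).

Section banach_lattice.
Context {R : realType} {E : banachLatticeType R}.

Definition Sol (A : set E) : set E :=
  [set y | exists2 x, A x & lle (labs y) (labs x)].

Definition disjoint_sequence (u : nat -> E) : Prop :=
  forall m n, m != n -> lmeet (labs (u m)) (labs (u n)) = 0.

Definition disjointly_weakly_compact (A : set E) : Prop :=
  bounded_set A /\
  forall u : nat -> E, disjoint_sequence u -> (forall n, Sol A (u n)) ->
    weakly_null u.

Definition order_interval (a b : E) : set E :=
  [set x | lle a x && lle x b].

Definition DW_compact (Y : normedModType R) (T : {linear E -> Y}) : Prop :=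
  bounded_fun_norm T /\
  forall A : set E, disjointly_weakly_compact A -> precompact (T @` A).

End banach_lattice.

Definition d_DP_property (R : realType) (E : banachLatticeType R) : Prop :=
  forall A : set E, disjointly_weakly_compact A -> dunford_pettis_set A.

(* Main.v *)
(* (1) => (2): disjoint order bounded sequences are weakly null, and so are disjoint
   sequences in the solid hull of a relatively weakly compact set A: if x_n is
   disjoint and |x_n| <= |y_n| with y_n in A, the restrictions of |f| to the ideals
   generated by the x_n are seminorms whose sum is at most |f|; norming them at y_n
   gives functionals g_n with |f(x_n)| <= 2 g_n(y_n) and \sum_n |g_n(x)| <= |f||x|,
   and a gliding hump shows that g_n(y_n) -> 0.
   (2) => (1): if f_n is weakly null, then f_n(v_k) -> 0 uniformly in n for each
   disjoint sequence v_k in Sol(A), so that up to e the set A is dominated by an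
   order interval, on which f_n -> 0 uniformly.
   (1) => (3): for weakly compact T and |g_n| <= 1, the sequence g_n o T has
   differences of a subsequence tending weakly to 0, hence uniformly on a
   Dunford-Pettis set A; so the g o T, |g| <= 1, are totally bounded for uniform
   convergence on A, and by duality T(A) is totally bounded.
   (4) => (1): a weakly null sequence (f_n) defines the weakly compact operator
   x |-> (f_n(x))_n into c_0, and relatively compact subsets of c_0 have uniformly
   small tails. *)
Require Import Defs.
From HB Require Import structures.
From mathcomp Require Import all_boot all_order all_algebra.
From mathcomp Require Import all_classical all_reals all_analysis.
From mathcomp Require Import ring lra.
Import Order.TTheory GRing.Theory Num.Theory.
Import numFieldNormedType.Exports.

Set Implicit Arguments.
Unset Strict Implicit.
Unset Printing Implicit Defensive.

Local Open Scope classical_set_scope.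
Local Open Scope ring_scope.

(** * Hahn-Banach theorem *)

(** Dependent choice in which each term may be constrained by the whole list of earlier ones; [H]
    accumulates that list. It drives the subsequence extractions below. *)
Lemma history_choice (T : Type) (P : seq T -> T -> Prop) :
  (forall l, exists x, P l x) ->
  exists s : nat -> T, forall k, P (mkseq s k) (s k).
Proof.
move=> /choice[c cP].
pose H := fix H n := if n is m.+1 then rcons (H m) (c (H m)) else [::].
have HE n : mkseq (fun k => c (H k)) n = H n.
  by elim: n => [//|n IH]; rewrite mkseqS IH.
by exists (fun k => c (H k)) => k; rewrite HE; exact: cP.
Qed.

Section hahn_banach.
Context {R : realType} {V : lmodType R}.

Definition sublinear (p : V -> R) :=
  (forall x y, p (x + y) <= p x + p y) /\
  (forall (a : R) x, 0 <= a -> p (a *: x) = a * p x).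

Lemma sublinear0 p : sublinear p -> p 0 = 0.
Proof. by case=> _ /(_ 0 0 (lexx _)); rewrite scale0r mul0r. Qed.

Lemma sublinear_ge p x : sublinear p -> - p (- x) <= p x.
Proof.
move=> sp; have [pD _] := sp; have := pD x (- x).
by rewrite subrr (sublinear0 sp); lra.
Qed.

(* The greatest sublinear minorant of [p] that is additive in the direction [y];
   a minimal sublinear functional equals all of these, hence is linear. *)
Let dir (p : V -> R) (y x : V) : R :=
  inf [set p (x + t *: y) - t * p y | t in [set t | 0 <= t]].

Let dir_lb p y x t : sublinear p -> 0 <= t ->
  - p (- x) <= p (x + t *: y) - t * p y.
Proof.
move=> [pD pZ] t0; have := pD (x + t *: y) (- x).
by rewrite addrC addKr pZ//; lra.
Qed.

Let dir_has_inf p y x : sublinear p ->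
  has_inf [set p (x + t *: y) - t * p y | t in [set t | 0 <= t]].
Proof.
move=> sp; split; first by exists (p (x + 0 *: y) - 0 * p y), 0 => /=.
by exists (- p (- x)) => _ [t /= t0 <-]; exact: dir_lb.
Qed.

Let dir_le p y x t : sublinear p -> 0 <= t ->
  dir p y x <= p (x + t *: y) - t * p y.
Proof.
move=> sp t0; apply: ge_inf; first by have [] := dir_has_inf y x sp.
by exists t.
Qed.

Let le_dir p y x c : (forall t, 0 <= t -> c <= p (x + t *: y) - t * p y) ->
  c <= dir p y x.
Proof.
move=> h; apply: lb_le_inf; first by exists (p (x + 0 *: y) - 0 * p y), 0 => /=.
by move=> _ [t /= t0 <-]; exact: h.
Qed.

Let dir_sublinear p y : sublinear p -> sublinear (dir p y).
Proof.
move=> sp; have [pD pZ] := sp; split.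
  move=> x z; rewrite -lerBlDr; apply: le_dir => t t0.
  rewrite lerBlDr -lerBlDl; apply: le_dir => s s0.
  rewrite lerBlDl.
  apply: (le_trans (dir_le y (x + z) sp (addr_ge0 t0 s0))).
  have := pD (x + t *: y) (z + s *: y).
  by rewrite addrACA -scalerDl; lra.
move=> a x; rewrite le_eqVlt => /predU1P[<-|a0].
  rewrite scale0r mul0r; apply/eqP; rewrite eq_le; apply/andP; split.
    by have := dir_le y 0 sp (lexx 0); rewrite scale0r addr0 (sublinear0 sp); lra.
  by apply: le_dir => t t0; rewrite add0r pZ// subrr.
apply/eqP; rewrite eq_le; apply/andP; split.
  rewrite -ler_pdivrMl//; apply: le_dir => t t0.
  rewrite ler_pdivrMl//.
  have := dir_le y (a *: x) sp (mulr_ge0 (ltW a0) t0).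
  by rewrite -scalerA -scalerDr (pZ _ _ (ltW a0)) mulrBr mulrA.
apply: le_dir => t t0.
have ta : 0 <= a^-1 * t by rewrite mulr_ge0// invr_ge0 ltW.
have := dir_le y x sp ta.
rewrite -(ler_pM2l a0) => /le_trans; apply.
by rewrite mulrBr -(pZ _ _ (ltW a0)) scalerDr scalerA !mulrA mulfV ?gt_eqF ?mul1r.
Qed.

(** Zorn's lemma for the reversed pointwise order. A chain is bounded by its pointwise infimum,
    which is finite because every sublinear [q] below [p] satisfies
    [- p (- x) <= - q (- x) <= q x]. *)
Lemma minimal_sublinear p : sublinear p ->
  exists q, [/\ sublinear q, forall x, q x <= p x &
    forall r, sublinear r -> (forall x, r x <= q x) -> r = q].
Proof.
move=> sp.
pose T := {q : V -> R | sublinear q /\ forall x, q x <= p x}.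
pose le (q r : T) := `[< forall x, sval r x <= sval q x >].
have [||||q qmin] := @Zorn T le.
- by move=> q; apply/asboolP.
- move=> q r s /asboolP qr /asboolP rs; apply/asboolP => x.
  exact: le_trans (rs x) (qr x).
- move=> [q Pq] [r Pr] /asboolP/= qr /asboolP/= rq.
  by apply/eq_exist/funext => x; apply/eqP; rewrite eq_le qr rq.
- move=> A totA.
  have [[q0 Aq0]|nA] := pselect (exists q, A q); last first.
    exists (exist _ p (conj sp (fun x => lexx _))) => s As.
    by exfalso; apply: nA; exists s.
  have hi x : has_inf [set sval q x | q in A].
    split; first by exists (sval q0 x), q0.
    exists (- p (- x)) => _ [q Aq <-].
    have [sq qp] := svalP q.
    by rewrite (le_trans _ (sublinear_ge x sq))// lerN2.
  pose m x := inf [set sval q x | q in A].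
  have m_le q x : A q -> m x <= sval q x.
    by move=> Aq; apply: ge_inf; [have [] := hi x|exists q].
  have le_m c x : (forall q, A q -> c <= sval q x) -> c <= m x.
    move=> h; apply: lb_le_inf; first by have [] := hi x.
    by move=> _ [q Aq <-]; exact: h.
  have sm : sublinear m.
    split=> [x y|a x a0].
      rewrite -lerBlDr; apply: (le_m) => q Aq; rewrite lerBlDr -lerBlDl.
      apply: (le_m) => r Ar; rewrite lerBlDl.
      have [[qD _] _] := svalP q; have [[rD _] _] := svalP r.
      (* Of two members of the chain, the smaller one is used at both points, so its own
         subadditivity suffices. *)
      have [/asboolP qr|/asboolP rq] := totA _ _ Aq Ar.
        rewrite (le_trans (m_le r (x + y) Ar))// (le_trans (rD _ _))//.
        by rewrite lerD2r.
      rewrite (le_trans (m_le q (x + y) Aq))// (le_trans (qD _ _))//.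
      by rewrite lerD2l.
    move: a0; rewrite le_eqVlt => /predU1P[<-|a0].
      rewrite scale0r mul0r; apply/eqP; rewrite eq_le; apply/andP; split.
        have [sq0 _] := svalP q0.
        by rewrite (le_trans (m_le q0 0 Aq0))// (sublinear0 sq0).
      by apply: (le_m) => q Aq; have [sq _] := svalP q; rewrite (sublinear0 sq).
    apply/eqP; rewrite eq_le; apply/andP; split.
      rewrite -ler_pdivrMl//; apply: (le_m) => q Aq; rewrite ler_pdivrMl//.
      have [[_ qZ] _] := svalP q.
      by rewrite -(qZ _ _ (ltW a0)); exact: m_le.
    apply: (le_m) => q Aq; have [[_ qZ] _] := svalP q.
    by rewrite (qZ _ _ (ltW a0)) ler_pM2l//; exact: m_le.
  have mp x : m x <= p x.
    by have [_ q0p] := svalP q0; rewrite (le_trans (m_le q0 x Aq0)).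
  by exists (exist _ m (conj sm mp)) => s As; apply/asboolP => x; exact: m_le.
have [sq qp] := svalP q; exists (sval q); split=> // r sr rq.
pose r' : T := exist _ r (conj sr (fun x => le_trans (rq x) (qp x))).
by rewrite -(qmin r')//; exact/asboolP.
Qed.

(** A minimal [q] below [dir p x0] equals every [dir q y], which makes it additive. Starting from
    [dir p x0] instead of [p] secures the value at [x0]: the parameter 1 in the infimum gives
    [q (- x0) <= p 0 - p x0]. *)
Theorem hahn_banach p x0 : sublinear p ->
  exists f : V -> R, [/\ linear f, forall x, f x <= p x & f x0 = p x0].
Proof.
move=> sp; have [q [sq qp qmin]] := minimal_sublinear (dir_sublinear x0 sp).
have [qD qZ] := sq.
have qdir y x : q x <= q (x + y) - q y.
  have qy : dir q y = q.
    apply: qmin; first exact: dir_sublinear.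
    by move=> z; have := dir_le y z sq (lexx 0); rewrite scale0r addr0 mul0r subr0.
  by have := dir_le y x sq ler01; rewrite qy scale1r mul1r.
have qadd x y : q (x + y) = q x + q y.
  by apply/eqP; rewrite eq_le qD/=; have := qdir y x; lra.
have qN x : q (- x) = - q x.
  by have := qadd x (- x); rewrite subrr (sublinear0 sq); lra.
have qscale a x : q (a *: x) = a * q x.
  have [a0|a0] := leP 0 a; first exact: qZ.
  have a0' : 0 <= - a by rewrite oppr_ge0 ltW.
  by apply: oppr_inj; rewrite -qN -scaleNr (qZ _ _ a0') mulNr.
have qp' x : q x <= p x.
  rewrite (le_trans (qp x))//; have := dir_le x0 x sp (lexx 0).
  by rewrite scale0r addr0 mul0r subr0.
exists q; split=> //; first by move=> a x y; rewrite qadd qscale.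
apply/eqP; rewrite eq_le qp'/= -lerN2 -qN (le_trans (qp _))//.
have := dir_le x0 (- x0) sp ler01.
by rewrite scale1r addNr (sublinear0 sp) mul1r sub0r.
Qed.

End hahn_banach.

(** * Ultrafilter limits and dual spaces *)

Section ultrafilters.

Lemma ultra_fmap (T U : Type) (f : T -> U) (F : set_system T) :
  UltraFilter F -> UltraFilter (f @ F).
Proof.
move=> FU; split; first exact: fmap_proper_filter.
move=> G GF FG; apply/seteqP; split=> // A GA.
have [//|FA] := in_ultra_setVsetC (f @^-1` A) FU.
have [x []] : (A `&` ~` A) !=set0.
  by apply: (@filter_ex _ G); apply: filterI => //; exact: FG.
by [].
Qed.

Lemma ultra_bounded_cvg (R : realType) (T : Type) (F : set_system T)
    (u : T -> R) (M : R) : UltraFilter F ->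
  (\forall t \near F, `|u t| <= M) -> cvg (u @ F).
Proof.
move=> FU uM; have := @segment_compact R (- M) M; rewrite compact_ultra.
have FM : (u @ F) [set` `[- M, M]].
  by apply: filterS uM => t; rewrite ler_norml /= in_itv.
by move=> /(_ _ (ultra_fmap u FU) FM)[l [_ ul]]; apply/cvg_ex; exists l.
Qed.

(** If convergence failed, the indices where [u] stays [e] away from [l] would carry an ultrafilter
    finer than [\oo]. *)
Lemma cvg_ultra (R : realType) (u : nat -> R) (l : R) :
  (forall F, UltraFilter F -> \oo `<=` F -> u @ F --> l) -> u @ \oo --> l.
Proof.
move=> h; apply/cvgrPdist_lt => e e0; apply: contrapT => ne.
pose D := [set n | e <= `|l - u n|].
have PF : ProperFilter (within D \oo).
  split; last exact: within_filter.
  move=> [N _ DN]; apply: ne; exists N => // n Nn /=.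
  by rewrite ltNge; apply/negP => /DN; exact.
have [G [GU wG]] := ultraFilterLemma PF.
have Gl : u @ G --> l by apply: h => A A0; apply: wG; apply: filterS A0.
have /cvgrPdist_lt /(_ e e0) Ge := Gl.
have GD : G D by apply: wG; exact: withinT.
have [n [/= ]] : (D `&` [set n | `|l - u n| < e]) !=set0.
  by apply: (@filter_ex _ G); exact: filterI.
by move=> /le_lt_trans /[apply]; rewrite ltxx.
Qed.

End ultrafilters.

Section dual.
Context {R : realType} {X : normedModType R}.
Implicit Types (f g : dual_space X) (x : X).

HB.instance Definition _ f :=
  GRing.isLinear.Build R X R _ (dual_fun f) (@dual_linear R X f).

Lemma dualZ f (a : R) x : f (a *: x) = a * f x.
Proof. exact: linearZ. Qed.

Lemma dualBE f g x : (f - g) x = f x - g x. Proof. by []. Qed.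

Lemma dual_le f x : `|f x| <= `|f| * `|x|.
Proof.
have [->|x0] := eqVneq x 0; first by rewrite linear0 !normr0 mulr0.
have := dual_norm_ub f (x := `|x|^-1 *: x); rewrite normfZV// => /(_ (lexx _)).
by rewrite dualZ normrM normfV normr_id ler_pdivrMl ?normr_gt0// mulrC.
Qed.

Lemma dual_norm_bound f (C : R) : 0 <= C ->
  (forall x, `|f x| <= C * `|x|) -> `|f| <= C.
Proof.
move=> C0 fC; apply: dual_norm_le => x x1.
by rewrite (le_trans (fC x))// ler_piMr.
Qed.

Lemma mk_dual (f : X -> R) (C : R) : linear f ->
  (forall x, `|f x| <= C * `|x|) -> exists g : dual_space X, dual_fun g = f.
Proof.
move=> lf fC.
have fD : f \in dual_pred.
  apply/dual_predP; split => // r; exists (`|C| * r) => x xr.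
  rewrite (le_trans (fC x))// (le_trans (ler_norm _))// normrM normr_id.
  by rewrite ler_wpM2l.
by exists (Dual fD).
Qed.

Lemma norming_functional x : exists2 g : dual_space X, `|g| <= 1 & g x = `|x|.
Proof.
have sn : sublinear (fun y : X => `|y|).
  split; first exact: ler_normD.
  by move=> a y a0; rewrite normrZ ger0_norm.
have [f [lf fle fx]] := hahn_banach x sn.
have fC y : `|f y| <= 1 * `|y|.
  rewrite mul1r ler_norml fle andbT lerNl.
  have := fle (- y); rewrite normrN; apply: le_trans.
  (* Linearity at 0 gives [f 0 = 0], and then [f (- y) = - f y]. *)
  have := lf (-1) y 0; rewrite scaleN1r addr0.
  have := lf 1 0 0; rewrite scale1r addr0 -[LHS]add0r => /addIr.
  by rewrite scale1r => <-; rewrite addr0 scaleN1r => ->.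
have [g gf] := mk_dual lf fC.
by exists g; rewrite ?gf//; apply: dual_norm_bound => // y; rewrite gf.
Qed.

Lemma dual_separates x : (forall f, f x = 0) -> x = 0.
Proof.
move=> h; have [g _ gx] := norming_functional x.
by apply/eqP; rewrite -normr_eq0 -gx h.
Qed.

Lemma norm_le_dual x (M : R) :
  (forall f, `|f| <= 1 -> `|f x| <= M) -> `|x| <= M.
Proof.
move=> h; have [g g1 gx] := norming_functional x.
by rewrite -gx (le_trans (ler_norm _))// h.
Qed.

Lemma weakly_nullP (u : nat -> X) :
  weakly_null u <-> forall f, f (u n) @[n --> \oo] --> (0 : R).
Proof.
rewrite /weakly_null weak_cvgP; split=> h f; have := h f;
  by rewrite [f 0]linear0.
Qed.

(** Banach-Alaoglu for ultrafilters: bounded scalars converge along [F], and the pointwise limit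
    inherits linearity and the bound [M]. *)
Lemma ultra_dual_lim (T : Type) (F : set_system T) (e : T -> dual_space X)
    (M : R) : UltraFilter F -> (forall t, `|e t| <= M) ->
  exists g : dual_space X, forall x, e t x @[t --> F] --> g x.
Proof.
move=> FU eM.
have ex x : cvg (e t x @[t --> F]).
  apply: (@ultra_bounded_cvg _ _ _ _ (M * `|x|)); apply: nearW => t.
  by rewrite (le_trans (dual_le _ _))// ler_wpM2r.
have lf : linear (fun x => lim (e t x @[t --> F])).
  move=> a x y; apply: cvg_lim => //.
  rewrite (_ : (fun t => _) = (fun t => a * e t x + e t y)); last first.
    by apply/funext => t; exact: dual_linear.
  by apply: cvgD; [apply: cvgMr; exact: ex|exact: ex].
have bf x : `|lim (e t x @[t --> F])| <= M * `|x|.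
  apply: (cvgr_to_le (cvg_norm (ex x))).
  by apply: nearW => t; rewrite (le_trans (dual_le _ _))// ler_wpM2r.
by have [g gE] := mk_dual lf bf; exists g => x; rewrite gE; exact: ex.
Qed.

Lemma bounded_setP (A : set X) :
  bounded_set A <-> exists M : R, forall x, A x -> `|x| <= M.
Proof.
split=> [/pinfty_ex_gt0[M _ AM]|[M AM]]; first by exists M.
exists M; split=> [|N MN x /AM xM /=]; [exact: num_real|].
by rewrite (le_trans xM)// ltW.
Qed.

End dual.

Lemma bidual_eval (R : realType) (X : normedModType R) (x : X) : exists phi : dual_space (dual_space X),
  forall f, phi f = f x.
Proof.
have lx : linear (fun f : dual_space X => f x) by [].
have bx (f : dual_space X) : `|f x| <= `|x| * `|f| by rewrite mulrC dual_le.
by have [phi phiE] := mk_dual lx bx; exists phi => f; rewrite phiE.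
Qed.

(** * Weak topology and uniform boundedness *)

Section weak_topology.
Context {R : realType} {X : normedModType R}.

Lemma weak_hausdorff : hausdorff_space (weak_space X).
Proof.
move=> x y; rewrite cluster_cvgE => -[F FF [Fy xF]].
have Fx : F --> (x : weak_space X) by [].
apply/eqP; rewrite -subr_eq0; apply/eqP/dual_separates => f.
have /weak_cvgP/(_ f) fx := Fx; have /weak_cvgP/(_ f) fy := Fy.
by rewrite linearB/= (cvg_unique _ fx fy)// subrr.
Qed.

Lemma relatively_weakly_compact_ultra (K : set X) :
  (forall F : set_system X, UltraFilter F -> F K ->
    exists2 x, K x & forall f : dual_space X, f y @[y --> F] --> f x) ->
  relatively_weakly_compact K.
Proof.
move=> h; apply: compact_precompact; first exact: weak_hausdorff.
rewrite compact_ultra => F FU FK; have [x Kx xF] := h F FU FK.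
by exists x; split=> //=; apply/weak_cvgP.
Qed.

Lemma ultra_weak_lim (T : Type) (F : set_system T) (A : set X) (u : T -> X) :
  UltraFilter F -> relatively_weakly_compact A -> (forall t, A (u t)) ->
  exists x, forall f : dual_space X, f (u t) @[t --> F] --> f x.
Proof.
move=> FU [K AK [+ _]] Au; rewrite compact_ultra.
have FK : F (u @^-1` K) by apply: filterE => t; exact: AK (Au t).
move=> /(_ _ (ultra_fmap u FU) FK)[x [_ ux]].
by exists x => f; move/weak_cvgP : ux => /(_ f).
Qed.

(** An ultrafilter on the range with 0 added either converges weakly to 0 or avoids some weak
    neighbourhood of 0; in the latter case it lives on finitely many terms. *)
Lemma weakly_null_rwc (u : nat -> X) :
  weakly_null u -> relatively_weakly_compact (range u).
Proof.
move=> u0; apply: (@precompact_subset (weak_space X) _ (range u `|` [set 0])).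
  exact: subsetUl.
apply: relatively_weakly_compact_ultra => F FU FK.
have [F0|] := pselect (forall f : dual_space X, f y @[y --> F] --> (0 : R)).
  by exists 0 => [|f]; [right|rewrite linear0; exact: F0].
move=> /existsNP[f /cvgrPdist_lt/existsNP[e /not_implyP[e0 Fe]]].
have /weakly_nullP/(_ f)/cvgrPdist_lt/(_ e e0)[N _ fN] := u0.
have FN : F [set u n | n in [set n | (n < N)%N]].
  have [//|FD] := in_ultra_setVsetC [set y : X | `|0 - f y| < e] FU.
  apply: filterS (filterI FK FD) => y [[[n _ <-]|->]] /=.
    move=> fe; exists n => //=; rewrite ltnNge; apply/negP => Nn.
    by apply: fe; exact: fN.
  by rewrite linear0 subrr normr0 => /(_ e0).
have : compact ([set u n | n in [set n | (n < N)%N]] : set (weak_space X)).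
  by apply: finite_compact; apply: finite_image; exact: finite_II.
rewrite compact_ultra => /(_ F FU FN)[_ [[n nN <-] Fx]].
by exists (u n); [left; exists n|apply/weak_cvgP].
Qed.
End weak_topology.

Section dual_complete.
Context {R : realType} {X : normedModType R}.

(** A Cauchy filter converges pointwise, with an error at most [e] times the norm of the point.
    Completeness lets the uniform boundedness principle be applied to [dual_space X] itself. *)
Let dual_complete (F : set_system (dual_space X)) :
  ProperFilter F -> cauchy F -> cvg F.
Proof.
move=> FF /cauchyP Fc.
have near_cauchy (e : R) : 0 < e -> exists2 u : dual_space X,
    F [set v : dual_space X | `|u - v| <= e] &
    F [set v : dual_space X | forall x, `|u x - v x| <= e * `|x|].
  move=> e0; have [u Fu] := Fc _ e0; exists u; apply: filterS Fu => v.
    by rewrite -ball_normE/= => /ltW.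
  rewrite -ball_normE /= => /ltW uv x.
  by rewrite (le_trans (dual_le (u - v) x))// ler_wpM2r.
have Fx x : cvg ((fun u : dual_space X => u x) @ F).
  apply: R_complete; apply/cauchyP => e e0.
  have d0 : 0 < e / (2 * (`|x| + 1)) by rewrite divr_gt0// mulr_gt0// ltr_wpDl.
  have [u _ Fu] := near_cauchy _ d0.
  exists (u x); rewrite /= /fmap/=; apply: filterS Fu => v uv.
  rewrite -ball_normE /=; apply: (le_lt_trans (uv x)).
  rewrite -mulrA gtr_pMr// invfM -mulrA mulrC -mulrA.
  rewrite ltr_pdivrMl// mulr1 ltr_pdivrMr ?ltr_wpDl//.
  by have := normr_ge0 x; lra.
pose l x := lim ((fun u : dual_space X => u x) @ F).
have lP (e : R) : 0 < e ->
    F [set u : dual_space X | forall x, `|u x - l x| <= e * `|x|].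
  move=> e0; have e20 : 0 < e / 2 by rewrite divr_gt0.
  have [u _ Fu] := near_cauchy _ e20; apply: (filterS _ Fu) => v /= uv x.
  have : `|u x - l x| <= e / 2 * `|x|.
    have ul : (fun w : dual_space X => `|u x - w x|) @ F --> `|u x - l x|.
      by apply: cvg_norm; apply: cvgB; [exact: cvg_cst|exact: Fx].
    by apply: (cvgr_to_le ul); apply: (filterS _ Fu) => w; exact.
  move: (uv x); rewrite !ler_norml; lra.
have ll : linear l.
  move=> a x y; apply: cvg_lim => //.
  have -> : (fun u : dual_space X => u (a *: x + y)) = (fun u => a * u x + u y).
    by apply/funext => t; exact: dual_linear.
  by apply: cvgD; [apply: cvgMr; exact: Fx|exact: Fx].
have [u ul] := filter_ex (lP 1 ltr01).
have lb x : `|l x| <= (1 + `|u|) * `|x|.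
  rewrite mulrDl; have := ul x; have := dual_le u x.
  by rewrite !ler_norml; lra.
have [g gl] := mk_dual ll lb.
apply/cvg_ex; exists g; apply/cvgrPdist_le => e e0.
apply: filterS (lP _ e0) => v vl.
apply: dual_norm_bound => [|x]; first exact: ltW.
by rewrite distrC -gl in vl *; exact: vl.
Qed.

HB.instance Definition _ :=
  Uniform_isComplete.Build (dual_space X) dual_complete.

End dual_complete.

Section uniform_boundedness.
Context {R : realType}.

Lemma pointwise_bounded_dual (X : completeNormedModType R)
    (F : set (dual_space X)) :
  (forall x, exists M : R, forall f, F f -> `|f x| <= M) ->
  exists M : R, forall f, F f -> `|f| <= M.
Proof.
move=> Fx; pose G : set (X -> R^o) := [set (f : X -> R^o) | f in F].
have [||M GM] := @Banach_Steinhauss R X R^o G _ _ 1.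
- by move=> _ [f Ff <-]; have [] := dual_predP _ (dual_funP f).
- by move=> x; have [M FM] := Fx x; exists M => _ [f Ff <-]; exact: FM.
exists M => f Ff; apply: dual_norm_le => x x1.
by apply: (GM f) => //; exists f.
Qed.

(** Seen in the bidual, [A] is a pointwise bounded family on the Banach space [dual_space X];
    norming functionals bring the bound back to [X]. *)
Lemma weakly_bounded_bounded (X : normedModType R) (A : set X) :
  (forall f : dual_space X, exists M : R, forall x, A x -> `|f x| <= M) ->
  exists M : R, forall x, A x -> `|x| <= M.
Proof.
move=> Af.
pose F := [set phi : dual_space (dual_space X) |
  exists2 x, A x & forall f, phi f = f x].
have [|M FM] := @pointwise_bounded_dual (dual_space X) F.
  by move=> f; have [M fM] := Af f; exists M => phi [x Ax ->]; exact: fM.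
exists M => x Ax; apply: norm_le_dual => f f1.
have [phi phiE] := bidual_eval x; rewrite -phiE.
have phiM : `|phi| <= M by apply: FM; exists x.
by rewrite (le_trans (dual_le _ _))// -[M]mulr1 ler_pM.
Qed.

Lemma relatively_weakly_compact_bounded (X : normedModType R) (A : set X) :
  relatively_weakly_compact A -> bounded_set A.
Proof.
move=> [K AK [cK _]]; apply/bounded_setP/weakly_bounded_bounded => f.
have cf : continuous (f : weak_space X -> R).
  by move=> x; have /weak_cvgP := @cvg_id _ (nbhs (x : weak_space X)); exact.
have /compact_bounded/bounded_setP[M fM] : compact (f @` (K : set (weak_space X))).
  by apply: continuous_compact => //; exact: continuous_subspaceT.
by exists M => x /AK Kx; apply: fM; exists x.
Qed.

Lemma weakly_null_bounded (X : normedModType R) (u : nat -> X) :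
  weakly_null u -> exists M : R, forall n, `|u n| <= M.
Proof.
move=> /weakly_null_rwc/relatively_weakly_compact_bounded/bounded_setP[M uM].
by exists M => n; apply: uM; exists n.
Qed.

End uniform_boundedness.

(** * Helly's lemma *)

Section helly.
Context {R : realType} {X : normedModType R}.

(** The ball is symmetric, so a one-sided bound controls the absolute value. *)
Lemma dual_ball_sup (g : dual_space X) (C B : R) : 0 < C ->
  (forall x, `|x| <= C -> g x <= B) -> C * `|g| <= B.
Proof.
move=> C0 gB; rewrite mulrC -ler_pdivlMr//; apply: dual_norm_le => x x1.
have CxC : `|C *: x| <= C by rewrite normrZ gtr0_norm// ler_piMr// ltW.
have NCxC : `|- (C *: x)| <= C by rewrite normrN.
have : `|g (C *: x)| <= B by rewrite ler_norml gB// andbT lerNl -linearN gB.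
by rewrite dualZ normrM gtr0_norm// mulrC ler_pdivlMr.
Qed.

Lemma dual_sumE (n : nat) (c : nat -> R) (h : nat -> dual_space X) x :
  (\sum_(i < n) c i *: h i : dual_space X) x = \sum_(i < n) c i * h i x.
Proof.
have [phi phiE] := bidual_eval x; rewrite -phiE linear_sum /=.
by apply: eq_bigr => i _; rewrite linearZ /= phiE.
Qed.

(* Otherwise an almost nearest point [u] to [(phi (h i))_i] in the image of the
   ball would give the functional [\sum_i (phi (h i) - h i u) *: h i] whose value
   at [phi] exceeds its supremum on the ball. *)
Lemma helly (phi : dual_space (dual_space X)) (h : nat -> dual_space X)
    (n : nat) (C e : R) : 0 < C -> `|phi| <= C -> 0 < e ->
  exists2 x, `|x| <= C & forall i, (i < n)%N -> `|h i x - phi (h i)| <= e.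
Proof.
move=> C0 phiC e0; apply: contrapT => far.
pose dist2 x := \sum_(i < n) (h i x - phi (h i)) ^+ 2.
have dist2_ge x : `|x| <= C -> e ^+ 2 <= dist2 x.
  move=> xC; apply: contrapT => /negP; rewrite -ltNge => lt.
  apply: far; exists x => // i ni.
  rewrite -ler_sqr ?nnegrE ?(ltW e0)// real_normK ?num_real//.
  apply: le_trans (ltW lt); rewrite /dist2 (bigD1 (Ordinal ni))//= lerDl.
  by apply: sumr_ge0 => j _; exact: sqr_ge0.
pose S := [set dist2 x | x in [set x | `|x| <= C]].
have Si : has_inf S.
  split; first by exists (dist2 0), 0 => //=; rewrite normr0 ltW.
  by exists (e ^+ 2) => _ [x xC <-]; exact: dist2_ge.
pose D := inf S.
have D0 : 0 < D.
  apply: lt_le_trans (_ : 0 < e ^+ 2) _; first by rewrite exprn_gt0.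
  apply: lb_le_inf; first by case: Si.
  by move=> _ [x xC <-]; exact: dist2_ge.
have DS x : `|x| <= C -> D <= dist2 x.
  by move=> xC; apply: ge_inf; [case: Si|exists x].
(* [K - D] bounds the quadratic term in the expansion below, since [x - u] has norm at most [2 * C].
   The summand [D] makes [K] positive and keeps [t = D / (2 K)] below 1. *)
pose K := D + \sum_(i < n) (2 * C * `|h i|) ^+ 2.
have KD : D <= K by rewrite lerDl; apply: sumr_ge0 => i _; exact: sqr_ge0.
have K0 : 0 < K := lt_le_trans D0 KD.
have [t [t0 t1 tK]] : exists t : R, [/\ 0 < t, t <= 1 & t * K = D / 2].
  exists (D / (2 * K)); split; first by rewrite divr_gt0// mulr_gt0.
    by rewrite ler_pdivrMr ?mulr_gt0//; lra.
  by rewrite invfM !mulrA divfK ?gt_eqF.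
have [_ [u uC <-] uD] : exists2 d, S d & d < D + t * (D / 2).
  by apply: inf_adherent => //; rewrite mulr_gt0// divr_gt0.
pose c i := phi (h i) - h i u.
pose g : dual_space X := \sum_(i < n) c i *: h i.
have gle x : `|x| <= C -> g x <= g u + D / 2.
  move=> xC; rewrite -lerBlDl -linearB /= /g dual_sumE.
  (* Moving from [u] a fraction [t] towards [x] stays in the ball and cannot lower [dist2] under
     [D]. As [u] is optimal up to [t * (D / 2)], comparing the terms of first order in [t] gives
     [g (x - u) <= D / 2]. *)
  have xtC : `|u + t *: (x - u)| <= C.
    have -> : u + t *: (x - u) = (1 - t) *: u + t *: x.
      by rewrite scalerBr scalerBl scale1r addrA addrAC.
    rewrite (le_trans (ler_normD _ _))// !normrZ (gtr0_norm t0) ger0_norm ?subr_ge0//.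
    have : t * `|x| <= t * C by rewrite ler_wpM2l// ltW.
    have : (1 - t) * `|u| <= (1 - t) * C by rewrite ler_wpM2l// subr_ge0.
    lra.
  have := DS _ xtC.
  have -> : dist2 (u + t *: (x - u)) =
      dist2 u - 2 * t * (\sum_(i < n) c i * h i (x - u))
      + t ^+ 2 * \sum_(i < n) (h i (x - u)) ^+ 2.
    rewrite /dist2 2!mulr_sumr -sumrN -!big_split /=; apply: eq_bigr => i _.
    by rewrite (linearD (h i) u) /= dualZ /c; ring.
  have : t ^+ 2 * \sum_(i < n) (h i (x - u)) ^+ 2 <= t * (D / 2).
    rewrite -tK expr2 -mulrA ler_pM2l// ler_pM2l// (@le_trans _ _ (K - D))//.
      rewrite /K addrAC subrr add0r; apply: ler_sum => i _.
      rewrite -(real_normK (num_real (h i _))) ler_sqr ?nnegrE ?mulr_ge0 ?(ltW C0)//.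
      rewrite (le_trans (dual_le _ _))// mulrC ler_wpM2r//.
      by rewrite (le_trans (ler_normB _ _))// mulr_natl mulr2n lerD.
    by rewrite gerBl ltW.
  move=> h1 h2; rewrite -(ler_pM2l t0); lra.
have := dual_ball_sup C0 gle.
(* Contradiction: [phi g] exceeds [g u] by [dist2 u >= D], yet is at most
   [C * |g| <= g u + D / 2]. *)
have phig : phi g - g u = dist2 u.
  rewrite /g linear_sum dual_sumE /= -sumrB; apply: eq_bigr => i _.
  by rewrite dualZ /c; ring.
have : phi g <= C * `|g|.
  by rewrite (le_trans (ler_norm _))// (le_trans (dual_le _ _))// ler_wpM2r.
by have := DS u uC; lra.
Qed.

End helly.

(** * Weakly compact operators *)

Lemma near_forall_lt (T : Type) (F : set_system T) (Q : nat -> T -> Prop)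
    (N : nat) : Filter F -> (forall j, \forall t \near F, Q j t) ->
  \forall t \near F, forall j, (j < N)%N -> Q j t.
Proof.
move=> FF FQ; elim: N => [|N IH]; first exact: nearW.
apply: filterS2 IH (FQ N) => t tN QN j; rewrite ltnS leq_eqVlt.
by move=> /predU1P[->|/tN].
Qed.

Lemma ultrafilter_eventually : exists U : set_system nat,
  UltraFilter U /\ \oo `<=` U.
Proof. exact: ultraFilterLemma. Qed.

Lemma cvg_subfilter (R : realType) (T : Type) (F G : set_system T) (u : T -> R)
    (l : R) : F `<=` G -> u @ F --> l -> u @ G --> l.
Proof. by move=> FG ul B /ul; exact: FG. Qed.

Lemma near_inv_le (R : realType) (c e : R) : 0 < e ->
  \forall m \near \oo, c / m.+1%:R <= e.
Proof.
move=> e0; exists (Num.truncn (c / e)) => // m /= cm.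
rewrite ler_pdivrMr// mulrC -ler_pdivrMr//.
by rewrite (le_trans (ltW (truncnS_gt _)))// ler_nat ltnS.
Qed.

Section adjoint.
Context {R : realType} {X Y : normedModType R}.

Lemma bounded_opP (T : X -> Y) : bounded_fun_norm T ->
  exists2 M : R, 0 <= M & forall x, `|x| <= 1 -> `|T x| <= M.
Proof.
move=> /(_ 1)[M TM]; exists `|M| => // x /TM/le_trans; apply; exact: ler_norm.
Qed.

Lemma adjoint (T : {linear X -> Y}) (g : dual_space Y) :
  bounded_fun_norm T -> exists h : dual_space X, forall x, h x = g (T x).
Proof.
move=> bT; have lh : linear (g \o T : X -> R).
  by move=> a x y; rewrite /= linearP/= dual_linear.
have hP : (g \o T : X -> R) \in dual_pred.
  apply/dual_predP; split=> // r; have [M TM] := bT r.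
  exists (`|g| * M) => x /TM xM /=.
  by rewrite (le_trans (dual_le _ _))// ler_wpM2l.
by exists (Dual hP).
Qed.

(* [D] lists points of [X] realising, up to [1/(j+1)], every vector that the
   first functionals [h i] attain on a ball; by Helly's lemma it approximates
   every element of the bidual on them. *)
Lemma helly_countable (h : nat -> dual_space X) :
  exists D : nat -> X, forall (phi : dual_space (dual_space X)),
    exists C : R, forall n j, exists m, `|D m| <= C /\
      forall i, (i < n)%N -> `|h i (D m) - phi (h i)| <= 3 / j.+1%:R.
Proof.
(* A parameter is a radius, a precision [j] and a list of integers approximating the values of
   [j.+1 * h i]. There are countably many, so they can be coded by natural numbers. Parameters with
   no good point, and numbers coding no parameter, receive the point 0. *)
pose good (p : nat * nat * seq int) x := `|x| <= p.1.1%:R /\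
  forall i, (i < size p.2)%N ->
    `|p.1.2.+1%:R * h i x - (p.2`_i)%:~R| <= 2 :> R.
have /choice[d dP] : forall p, exists x, (exists x', good p x') -> good p x.
  move=> p; have [[x px]|np] := pselect (exists x, good p x); first by exists x.
  by exists 0 => px; exfalso; exact: np.
exists (fun m => if unpickle m is Some p then d p else 0) => phi.
pose C := (Num.truncn `|phi|).+1; exists C%:R => n j.
have C0 : 0 < C%:R :> R by rewrite ltr0n.
have phiC : `|phi| <= C%:R by rewrite ltW// truncnS_gt.
pose z : seq int := mkseq (fun i => Num.floor (j.+1%:R * phi (h i))) n.
exists (pickle ((C, j), z)); rewrite pickleK.
have j0 : 0 < j.+1%:R :> R by rewrite ltr0n.
have zE i : (i < n)%N -> `|j.+1%:R * phi (h i) - (z`_i)%:~R| <= 1.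
  move=> ni; rewrite nth_mkseq// ger0_norm ?subr_ge0 ?ge_floor//.
  by have := lt_succ_floor (j.+1%:R * phi (h i)); rewrite intrD; lra.
have [xC xz] : good ((C, j), z) (d ((C, j), z)).
  apply: dP.
  (* Helly's error 1 and the rounding error 1 give the tolerance 2 in [good]; rounding [phi (h i)]
     once more gives the final 3. *)
  have [x xC xphi] := helly h n C0 phiC (divr_gt0 ltr01 j0).
  exists x; split => // i /=; rewrite size_mkseq => ni.
  have : `|j.+1%:R * (h i x - phi (h i))| <= 1.
    rewrite normrM gtr0_norm// -ler_pdivlMl//.
    by rewrite mulrC; exact: xphi.
  by have := zE i ni; rewrite mulrBr !ler_norml; lra.
split=> // i ni; have := xz i; rewrite size_mkseq => /(_ ni)/=.
move=> hz; rewrite ler_pdivlMr// -[X in _ * X](gtr0_norm j0) -normrM mulrC.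
by have := zE i ni; move: hz; rewrite mulrBr !ler_norml; lra.
Qed.

(* The interchange of limits [lim_k lim_m g_k(T x_m) = lim_m lim_k g_k(T x_m)] is
   what weak compactness of [T] provides. *)
Lemma weakly_null_differences (T : {linear X -> Y}) (g : nat -> dual_space Y)
    (h : nat -> dual_space X) : weakly_compact_operator T ->
  (forall n, `|g n| <= 1) -> (forall n x, h n x = g n (T x)) ->
  exists s : nat -> nat, (forall k, (s k < s k.+1)%N) /\
    weakly_null (fun k => h (s k.+1) - h (s k)).
Proof.
move=> [bT cT] g1 hE; have [M M0 TM] := bounded_opP bT.
have [U [UU ooU]] := ultrafilter_eventually.
have [D DP] := helly_countable h.
have hM n : `|h n| <= M.
  apply: dual_norm_le => x /TM xM; rewrite hE (le_trans (dual_le _ _))//.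
  by rewrite -[M]mul1r ler_pM.
have [l lP] := ultra_dual_lim UU hM.
(* Diagonal extraction: [h (s k)] is close to the ultrafilter limit [l] on the first [k] points of
   [D], which yields ordinary convergence along [s] at every point of [D]. *)
have [s sP] : exists s : nat -> nat, forall k,
    (forall m, m \in mkseq s k -> (m < s k)%N) /\
    forall j, (j < k)%N -> `|l (D j) - h (s k) (D j)| < k.+1%:R^-1.
  pose P (t : seq nat) n := (forall m, m \in t -> (m < n)%N) /\
    forall j, (j < size t)%N -> `|l (D j) - h n (D j)| < (size t).+1%:R^-1.
  have /history_choice[s sP] : forall t, exists n, P t n.
    move=> t.
    have ht : \forall n \near U, forall j, (j < size t)%N ->
        `|l (D j) - h n (D j)| < (size t).+1%:R^-1.
      apply: near_forall_lt => j; have /cvgrPdist_lt := lP (D j).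
      by apply; rewrite invr_gt0.
    have tn : \forall n \near U, (\max_(m <- t) m < n)%N.
      by apply: ooU; exists (\max_(m <- t) m).+1.
    have [n [tn' hn]] := filter_ex (filterI tn ht).
    by exists n; split=> // m mt; apply: leq_ltn_trans tn'; exact: leq_bigmax_seq.
  by exists s => k; have := sP k; rewrite /P size_mkseq.
have sS k : (s k < s k.+1)%N.
  have [h1 _] := sP k.+1; apply: h1.
  by rewrite /mkseq map_f// mem_iota /= add0n ltnS leqnn.
have hD j : h (s k) (D j) @[k --> \oo] --> l (D j).
  apply/cvgrPdist_lt => e e0; near=> k.
  have [_ /(_ j)] := sP k.
  have jk : (j < k)%N by near: k; exists j.+1.
  move=> /(_ jk)/lt_trans; apply; near: k.
  exact: near_infty_natSinv_lt (PosNum e0).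
exists s; split=> //; apply/weakly_nullP => phi.
apply: cvg_ultra => F FU ooF.
have [C CP] := DP phi.
(* [x m] imitates [phi] on all [h i] up to index [s m.+1], hence on the first [m] differences and
   the next one. Weak compactness of [T] then gives a weak limit [y] of [T (x m)]. *)
have /choice[x xP] : forall m, exists x, (exists j, x = D j) /\ `|x| <= C /\
    forall i, (i < (s m.+1).+1)%N -> `|h i x - phi (h i)| <= 3 / m.+1%:R.
  by move=> m; have [j [DC hj]] := CP (s m.+1).+1 m; exists (D j); split; [exists j|split].
have [y yP] : exists y, forall e : dual_space Y, e (T (x m)) @[m --> F] --> e y.
  apply: (ultra_weak_lim FU (cT [set x | `|x| <= C] _)) => [|m].
    by apply/bounded_setP; exists C.
  by exists (x m) => //; have [_ []] := xP m.
(* [e k] takes at [y] the value of [phi] on the k-th difference. Its pointwise limit [e'] vanishes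
   at each [T (x m)], since [x m] is a point of [D], and therefore at [y]. *)
pose e k := g (s k.+1) - g (s k).
have e2 k : `|e k| <= 2.
  by rewrite (le_trans (ler_normB _ _))// (_ : 2 = 1 + 1)// lerD.
have [e' e'P] := ultra_dual_lim FU e2.
have eT k z : e k (T z) = (h (s k.+1) - h (s k)) z.
  by rewrite /e !dualBE !hE.
have ey k : e k y = phi (h (s k.+1) - h (s k)).
  apply: (cvg_unique _ (yP (e k))) => //.
  apply: (cvg_subfilter ooF); apply/cvgrPdist_le => r r0.
  (* Two approximations with error [3 / m.+1] each. *)
  have kr := near_inv_le 6 r0; near=> m; rewrite eT.
  have km : (k <= m)%N by near: m; exists k.
  have [_ [_ hm]] := xP m.
  have sm i : (i <= m.+1)%N -> (s i < (s m.+1).+1)%N.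
    move=> im; rewrite ltnS; apply: (homo_leq (r := leq)) im => //.
      by move=> a b c; exact: leq_trans.
    by move=> n; exact: ltnW.
  have := hm _ (sm _ (leqW km)); have := hm _ (sm k.+1 km).
  have : 6 / m.+1%:R <= r by near: m.
  by rewrite dualBE (linearB phi) !ler_norml; move: (m.+1%:R^-1) => c; lra.
have eT0 m : e' (T (x m)) = 0.
  have [[j ->] _] := xP m.
  apply: (cvg_unique _ (e'P (T (D j)))) => //.
  rewrite (funext (eT^~ (D j))).
  apply: (cvg_subfilter ooF); rewrite -(subrr (l (D j))); apply: cvgB.
    by rewrite (cvg_shiftS (fun k => h (s k) (D j))); exact: hD.
  exact: hD.
have e'y : e' y = 0.
  apply: (cvg_unique _ (yP e')) => //.
  by rewrite (funext eT0); exact: cvg_cst.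
by rewrite -e'y -(funext ey); exact: e'P.
Unshelve. all: by end_near. Qed.

End adjoint.

(** * Dunford-Pettis sets and weakly compact operators *)

Lemma dunford_pettis_setP (R : realType) (X : normedModType R) (A : set X) :
  dunford_pettis_set A <->
  bounded_set A /\ forall f : nat -> dual_space X, weakly_null f ->
    forall e : R, 0 < e ->
    \forall n \near \oo, forall x, A x -> `|f n x| <= e.
Proof.
split=> -[bA fA]; split=> // f f0.
  move=> e e0; have /bounded_setP[M AM] := bA.
  have /cvgrPdist_le/(_ e e0) := fA f f0; apply: filterS => n fn x Ax.
  (* Boundedness of [A] makes the set of values bounded above, so that [sup] is a true supremum. *)
  rewrite sub0r normrN in fn; apply: (le_trans _ (le_trans (ler_norm _) fn)).
  apply: ub_le_sup; last by exists x.
  exists (`|f n| * M) => _ [z /AM zM <-].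
  by rewrite (le_trans (dual_le _ _))// ler_wpM2l.
apply/cvgrPdist_le => e e0; apply: filterS (fA f f0 e e0) => n fn.
rewrite sub0r normrN; have [[x Ax]|nA] := pselect (A !=set0); last first.
  have -> : [set `|f n x| | x in A] = set0.
    by apply/seteqP; split=> // t [x Ax _]; apply: nA; exists x.
  by rewrite sup0 normr0 ltW.
have ub : ubound [set `|f n x| | x in A] e by move=> _ [z Az <-]; exact: fn.
rewrite ger0_norm.
  by apply: ge_sup => //; exists `|f n x|, x.
apply: le_trans (normr_ge0 (f n x)) _.
by apply: ub_le_sup; [exists e|exists x].
Qed.

Lemma dunford_pettis_net (R : realType) (X Y : normedModType R)
    (T : {linear X -> Y}) (A : set X) (e : R) :
  weakly_compact_operator T -> dunford_pettis_set A -> 0 < e ->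
  exists G : seq (dual_space Y), (forall g, g \in G -> `|g| <= 1) /\
    forall g : dual_space Y, `|g| <= 1 ->
      exists2 g', g' \in G & forall x, A x -> `|g (T x) - g' (T x)| <= e.
Proof.
move=> wT /dunford_pettis_setP[_ DPA] e0; apply: contrapT => noG.
(* The history ranges over arbitrary lists, so only its members in the unit ball are compared. *)
pose P (l : seq (dual_space Y)) (g : dual_space Y) := `|g| <= 1 /\
  forall g', g' \in l -> `|g'| <= 1 -> exists2 x, A x & e < `|g (T x) - g' (T x)|.
have /history_choice[g gP] : forall l, exists g, P l g.
  move=> l; apply: contrapT => nP; apply: noG.
  exists [seq g <- l | `|g| <= 1]; split=> [g|g g1].
    by rewrite mem_filter => /andP[].
  apply: contrapT => ng; apply: nP; exists g; split=> // g' g'l g'1.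
  apply: contrapT => nx; apply: ng; exists g'; first by rewrite mem_filter g'1.
  by move=> x Ax; rewrite leNgt; apply/negP => lt; apply: nx; exists x.
have g1 n : `|g n| <= 1 by have [] := gP n.
have /choice[h hE] : forall n, exists h : dual_space X, forall x, h x = g n (T x).
  by move=> n; apply: adjoint; have [] := wT.
have [s [sS d0]] := weakly_null_differences wT g1 hE.
have [n] := filter_ex (DPA _ d0 e e0).
have [_ /(_ (g (s n)))[]//] := gP (s n.+1).
  by rewrite /mkseq map_f// mem_iota /= add0n sS.
by move=> x Ax; rewrite ltNge => /negP + /(_ x Ax); rewrite dualBE !hE.
Qed.

Lemma dunford_pettis_precompact (R : realType) (X : normedModType R)
    (Y : completeNormedModType R) (T : {linear X -> Y}) (A : set X) :
  weakly_compact_operator T -> dunford_pettis_set A -> precompact (T @` A).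
Proof.
move=> wT DPA; rewrite precompactE compact_ultra => F FU FS.
set S := T @` A in FS *.
have [M SM] : exists M : R, forall y, closure S y -> `|y| <= M.
  have [/bounded_setP[r Ar] _] := DPA; have [/(_ r)[M TM] _] := wT.
  exists (M + 1) => y /(_ _ (nbhsx_ballx y 1 ltr01))[_ [[x Ax <-]]].
  rewrite -ball_normE/= => yT; have := TM x (Ar x Ax).
  have := ler_normD (y - T x) (T x); rewrite subrK; lra.
have gF (g : dual_space Y) : cvg (g y @[y --> F]).
  apply: (@ultra_bounded_cvg _ _ _ _ (`|g| * M)); apply: filterS FS => y Sy.
  by rewrite (le_trans (dual_le _ _))// ler_wpM2l// SM.
have : cvg F.
  apply: cauchy_cvg; apply/cauchyP => e e0.
  (* Passing from [g] to a net functional costs [3 * (e / 9)] on the closure (net error and two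
     approximations by a point of [S]). This happens at both [y0] and [y], and each is [e / 9] from
     the limit: [8 * (e / 9)] in all. *)
  have e9 : 0 < e / 9 by rewrite divr_gt0.
  have [G [G1 Gnet]] := dunford_pettis_net wT DPA e9.
  have GF : \forall y \near F, forall j, (j < size G)%N ->
      `|lim (G`_j z @[z --> F]) - G`_j y| <= e / 9.
    by apply: near_forall_lt => j; have /cvgrPdist_le := gF G`_j; exact.
  have net (g : dual_space Y) : `|g| <= 1 -> exists2 j, (j < size G)%N &
      forall y, closure S y -> `|g y - G`_j y| <= e / 3.
    move=> g1; have [g' g'G gg'] := Gnet g g1.
    exists (index g' G); rewrite ?index_mem// nth_index// => y Sy.
    have [_ [[x Ax <-]]] := Sy _ (nbhsx_ballx y _ e9).
    rewrite -ball_normE/= => /ltW yT.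
    have le1 (f : dual_space Y) : `|f| <= 1 -> `|f y - f (T x)| <= e / 9.
      move=> f1; rewrite -linearB (le_trans (dual_le _ _))//.
      by rewrite -[e / 9]mul1r ler_pM.
    have := le1 g g1; have := le1 g' (G1 g' g'G); have := gg' x Ax.
    by rewrite !ler_norml; lra.
  have [y0 [Sy0 y0G]] := filter_ex (filterI FS GF).
  exists y0; apply: filterS (filterI FS GF) => y [Sy yG].
  rewrite -ball_normE /=; apply: (@le_lt_trans _ _ (8 * (e / 9))); last by lra.
  apply: norm_le_dual => g g1; have [j jG gj] := net g g1.
  rewrite linearB; have := gj y Sy; have := gj y0 Sy0.
  by have := yG j jG; have := y0G j jG; rewrite !ler_norml; lra.
move=> /cvg_ex[y Fy]; exists y; split => //.
apply: (@closed_closure _ S) => B By.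
by apply: (@filter_ex _ F); apply: filterI => //; exact: Fy.
Qed.

(** * Banach lattices *)

Local Notation lpos x := (ljoin x 0).
Local Notation "x <=l y" := (lle x y) (at level 70, y at next level).

Section vector_lattice.
Context {R : realType} {E : banachLatticeType R}.
Implicit Types (x y z u v w : E) (a c : R).

Lemma llexx x : x <=l x. Proof. exact: lle_refl. Qed.

Lemma lle_transi x y z : x <=l y -> y <=l z -> x <=l z.
Proof. exact: lle_trans. Qed.

Lemma lleD x y z w : x <=l y -> z <=l w -> x + z <=l y + w.
Proof.
move=> xy zw; apply: lle_transi (lleD2r z _ _ xy) _.
by rewrite ![y + _]addrC; exact: lleD2r.
Qed.

Lemma lsub_ge0 x y : (0 <=l y - x) = (x <=l y).
Proof.
apply/idP/idP => h; first by have := lleD2r x _ _ h; rewrite add0r subrK.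
by have := lleD2r (- x) _ _ h; rewrite subrr.
Qed.

Lemma lle_subl x y z : (x - y <=l z) = (x <=l z + y).
Proof. by rewrite -lsub_ge0 opprB addrA lsub_ge0. Qed.

Lemma lleN2 x y : (- x <=l - y) = (y <=l x).
Proof. by rewrite -lsub_ge0 opprK addrC lsub_ge0. Qed.

Lemma lle_scale a x y : 0 <= a -> x <=l y -> a *: x <=l a *: y.
Proof.
move=> a0; rewrite -lsub_ge0 => xy; rewrite -lsub_ge0 -scalerBr.
exact: lscale_ge0.
Qed.

Lemma lle_scalel a c x : a <= c -> 0 <=l x -> a *: x <=l c *: x.
Proof.
move=> ac x0; rewrite -lsub_ge0 -scalerBl.
by apply: lscale_ge0 => //; rewrite subr_ge0.
Qed.

Lemma laddr_ge0 x y : 0 <=l x -> 0 <=l y -> 0 <=l x + y.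
Proof. by move=> x0 y0; have := lleD x0 y0; rewrite addr0. Qed.

Lemma ljoinl x y : x <=l ljoin x y.
Proof. by have := llexx (ljoin x y); rewrite lleUx => /andP[]. Qed.

Lemma ljoinr x y : y <=l ljoin x y.
Proof. by have := llexx (ljoin x y); rewrite lleUx => /andP[]. Qed.

Lemma lmeetl x y : lmeet x y <=l x.
Proof. by have := llexx (lmeet x y); rewrite llexI => /andP[]. Qed.

Lemma lmeetr x y : lmeet x y <=l y.
Proof. by have := llexx (lmeet x y); rewrite llexI => /andP[]. Qed.

Lemma lle_eq x y : x <=l y -> y <=l x -> x = y.
Proof. by move=> xy yx; apply: lle_anti; rewrite xy yx. Qed.

Lemma lmeetC x y : lmeet x y = lmeet y x.
Proof. by apply: lle_eq; rewrite llexI lmeetl lmeetr. Qed.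

Lemma lle_meet x y u v : x <=l u -> y <=l v -> lmeet x y <=l lmeet u v.
Proof.
move=> xu yv; rewrite llexI.
by rewrite (lle_transi (lmeetl _ _) xu) (lle_transi (lmeetr _ _) yv).
Qed.

Lemma labs_le x y : (labs x <=l y) = (x <=l y) && (- x <=l y).
Proof. exact: lleUx. Qed.

Lemma lle_labs x : x <=l labs x. Proof. exact: ljoinl. Qed.

Lemma lleN_labs x : - x <=l labs x. Proof. exact: ljoinr. Qed.

Lemma labs_ge0 x : 0 <=l labs x.
Proof.
have : 0 <=l labs x + labs x.
  by have := lleD (lle_labs x) (lleN_labs x); rewrite subrr.
rewrite -mulr2n -scaler_nat => /(lle_scale (a := 2^-1)).
by rewrite invr_ge0 ler0n scaler0 scalerA mulVf ?scale1r ?pnatr_eq0 //; apply.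
Qed.

Lemma labs_id x : 0 <=l x -> labs x = x.
Proof.
move=> x0; apply: lle_eq (lle_labs x).
rewrite labs_le llexx/=; apply: (lle_transi _ x0).
by rewrite -[0]oppr0 lleN2.
Qed.

Lemma labsN x : labs (- x) = labs x.
Proof.
have le z : labs (- z) <=l labs z by rewrite labs_le opprK lleN_labs lle_labs.
by apply: lle_eq (le x) _; rewrite -{1}[x]opprK; exact: le.
Qed.

Lemma labsD x y : labs (x + y) <=l labs x + labs y.
Proof.
by rewrite labs_le opprD !lleD// ?lle_labs ?lleN_labs.
Qed.

Lemma labs_scale a x : labs (a *: x) = `|a| *: labs x.
Proof.
have le c z : labs (c *: z) <=l `|c| *: labs z.
  have pos d : 0 <= d -> labs (d *: z) <=l d *: labs z.
    by move=> d0; rewrite labs_le -scalerN !lle_scale ?lle_labs ?lleN_labs.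
  have [c0|c0] := ger0P c; first exact: pos.
  by rewrite -labsN -scaleNr; apply: pos; rewrite oppr_ge0 ltW.
apply: lle_eq; first exact: le.
have [->|a0] := eqVneq a 0; first by rewrite normr0 scale0r labs_ge0.
have := lle_scale (normr_ge0 a) (le a^-1 (a *: x)).
by rewrite !scalerA mulVf// scale1r normfV mulfV ?normr_eq0// scale1r.
Qed.

Lemma lnorm_mono x y : labs x <=l labs y -> `|x| <= `|y|.
Proof. exact: lnorm_le. Qed.

Lemma norm_labs x : `|labs x| = `|x|.
Proof.
have h : labs (labs x) = labs x by exact/labs_id/labs_ge0.
by apply/eqP; rewrite eq_le !lnorm_mono// h llexx.
Qed.

Lemma lnorm_le_abs x y : labs x <=l y -> `|x| <= `|y|.
Proof. by move=> xy; apply: lnorm_mono; exact: lle_transi (lle_labs y). Qed.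

Lemma lpos_ge0 x : 0 <=l lpos x. Proof. exact: ljoinr. Qed.

Lemma lle_lpos x : x <=l lpos x. Proof. exact: ljoinl. Qed.

Lemma lpos_le x y : (lpos x <=l y) = (x <=l y) && (0 <=l y).
Proof. exact: lleUx. Qed.

Lemma lpos_mono x y : x <=l y -> lpos x <=l lpos y.
Proof. by move=> xy; rewrite lpos_le lpos_ge0 (lle_transi xy (lle_lpos y)). Qed.

Lemma lpos_labs x : lpos x <=l labs x.
Proof. by rewrite lpos_le lle_labs labs_ge0. Qed.

Lemma lposN_labs x : lpos (- x) <=l labs x.
Proof. by rewrite -labsN lpos_labs. Qed.

Lemma lpos_subN x : x = lpos x - lpos (- x).
Proof.
have le z : lpos z - z <=l lpos (- z).
  have := lleD2r z _ _ (lpos_ge0 (- z)); have := lleD2r z _ _ (lle_lpos (- z)).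
  by rewrite addNr add0r lle_subl lpos_le => -> ->.
have h : lpos x - x = lpos (- x).
  apply: lle_eq (le x) _.
  by have := lleD2r (- x) _ _ (le (- x)); rewrite subrK opprK.
by rewrite -h opprB addrC subrK.
Qed.

Lemma lpos_scale a x : 0 <= a -> lpos (a *: x) <=l a *: lpos x.
Proof.
by move=> a0; rewrite lpos_le lle_scale ?lle_lpos//= lscale_ge0// lpos_ge0.
Qed.

Lemma lmeet_ge0 x y : 0 <=l x -> 0 <=l y -> 0 <=l lmeet x y.
Proof. by move=> x0 y0; rewrite llexI x0 y0. Qed.

(** With [m] the meet, [lpos x - m] still dominates 0 and [x], because [lpos x - x = lpos (- x)]
    dominates [m]; so [lpos x] lies below it. *)
Lemma lmeet_lpos x : lmeet (lpos x) (lpos (- x)) = 0.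
Proof.
apply: lle_eq; last by apply: lmeet_ge0; exact: lpos_ge0.
set m := lmeet _ _.
have : lpos x <=l lpos x - m.
  rewrite lpos_le lsub_ge0 lmeetl andbT -lsub_ge0 addrAC.
  suff -> : lpos x - x = lpos (- x) by rewrite lsub_ge0 lmeetr.
  by rewrite [X in _ - X](lpos_subN x) opprB addrCA subrr addr0.
by rewrite -lsub_ge0 addrAC subrr sub0r -lleN2 opprK oppr0.
Qed.

Lemma lmeet_eq0 x y u v : 0 <=l x -> 0 <=l y -> x <=l u -> y <=l v ->
  lmeet u v = 0 -> lmeet x y = 0.
Proof.
move=> x0 y0 xu yv uv; apply: lle_eq; last exact: lmeet_ge0.
by rewrite -uv lle_meet.
Qed.

(** Both factors are raised to a common positive [d], which commutes with the meet; the added 1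
    makes [d] invertible even for [a = c = 0]. *)
Lemma lmeet_scale_eq0 a c x y : 0 <= a -> 0 <= c -> 0 <=l x -> 0 <=l y ->
  lmeet x y = 0 -> lmeet (a *: x) (c *: y) = 0.
Proof.
move=> a0 c0 x0 y0 xy; pose d := a + c + 1.
have d0 : 0 < d by rewrite /d; lra.
apply: lle_eq; last by apply: lmeet_ge0; exact: lscale_ge0.
have : lmeet (a *: x) (c *: y) <=l lmeet (d *: x) (d *: y).
  by apply: lle_meet; apply: lle_scalel => //; rewrite /d; lra.
move=> /lle_transi; apply.
have : d^-1 *: lmeet (d *: x) (d *: y) <=l 0.
  rewrite -xy llexI; have di : 0 <= d^-1 by rewrite invr_ge0 ltW.
  have := lle_scale di (lmeetl (d *: x) (d *: y)).
  have := lle_scale di (lmeetr (d *: x) (d *: y)).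
  by rewrite !scalerA mulVf ?gt_eqF// !scale1r => -> ->.
move=> /(lle_scale (ltW d0)).
by rewrite scalerA mulfV ?gt_eqF// scale1r scaler0.
Qed.

Lemma lmeetD_le x y z : 0 <=l x -> 0 <=l y -> 0 <=l z ->
  lmeet (x + y) z <=l lmeet x z + lmeet y z.
Proof.
move=> x0 y0 z0; set m := lmeet (x + y) z.
have mz : m <=l z := lmeetr _ _.
have sub_le u w : 0 <=l w -> u - w <=l u.
  by move=> w0; rewrite lle_subl -[X in X <=l _]addr0 lleD ?llexx.
have h1 : m - y <=l lmeet x z.
  rewrite llexI lle_subl lmeetl/=.
  exact: lle_transi (sub_le _ _ y0) mz.
have h2 : m - lmeet x z <=l lmeet y z.
  rewrite llexI; apply/andP; split.
    by rewrite lle_subl addrC -lle_subl.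
  by apply: lle_transi (sub_le _ _ _) mz; exact: lmeet_ge0.
by rewrite addrC -lle_subl.
Qed.

Lemma lmeetD_eq0 x y z : 0 <=l x -> 0 <=l y -> 0 <=l z ->
  lmeet x z = 0 -> lmeet y z = 0 -> lmeet (x + y) z = 0.
Proof.
move=> x0 y0 z0 xz yz; apply: lle_eq; last first.
  by apply: lmeet_ge0 => //; exact: laddr_ge0.
by have := lmeetD_le x0 y0 z0; rewrite xz yz addr0.
Qed.

(** [x + y - u] lies below both [x] and [y], hence below their meet. *)
Lemma ladd_disjoint_le x y u : lmeet x y = 0 -> x <=l u -> y <=l u ->
  x + y <=l u.
Proof.
move=> xy xu yu; rewrite -[u]add0r -lle_subl -xy llexI.
rewrite !lle_subl lleD ?llexx//=.
by rewrite addrC lleD ?llexx.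
Qed.

Lemma lpos_part_le x y : 0 <=l y -> lpos x - lpos (x - y) <=l y.
Proof.
move=> y0; rewrite lle_subl lpos_le laddr_ge0 ?lpos_ge0// andbT.
by rewrite addrC -lle_subl lle_lpos.
Qed.

(* Closedness of the positive cone: the negative part is 1-Lipschitz. *)
Lemma lim_lge0 (u : nat -> E) x : (\forall n \near \oo, 0 <=l u n) ->
  u @ \oo --> x -> 0 <=l x.
Proof.
move=> u0 ux.
have neg n : 0 <=l u n -> `|lpos (- x)| <= `|x - u n|.
  move=> un; rewrite -[leRHS]norm_labs; apply: lnorm_le_abs.
  rewrite labs_id ?lpos_ge0// lpos_le labs_ge0 andbT.
  apply: lle_transi _ (lleN_labs _); rewrite opprB -[X in X <=l _]add0r.
  exact: lleD2r.
have : `|lpos (- x)| <= 0.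
  apply/ler_addgt0Pr => e e0; rewrite add0r.
  move/cvgrPdist_le : ux => /(_ e e0) ux.
  have [n [un xn]] := filter_ex (filterI u0 ux).
  exact: le_trans (neg n un) xn.
rewrite normr_le0 => /eqP x0; rewrite (lpos_subN x) x0 subr0; exact: lpos_ge0.
Qed.

End vector_lattice.

(** * Summable families of functionals and the gliding hump *)

Lemma bounded_sum_cvg0 (R : realType) (a : nat -> R) (B : R) :
  (forall n, 0 <= a n) -> (forall N, \sum_(i < N) a i <= B) ->
  a @ \oo --> (0 : R).
Proof.
move=> a0 aB; apply: cvg_series_cvg_0; apply: nondecreasing_is_cvgn.
  by apply/nondecreasing_seqP => n; rewrite !seriesEnat/= big_nat_recr//= lerDl.
exists B => _ [n _ <-]; rewrite seriesEnat/= big_mkord; exact: aB.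
Qed.

Lemma sum_half_le (R : realType) (m : nat) :
  \sum_(i < m) (2^-1 : R) ^+ i <= 2.
Proof.
suff -> : \sum_(i < m) (2^-1 : R) ^+ i = 2 - 2 * 2^-1 ^+ m.
  by rewrite gerBl mulr_ge0// exprn_ge0// invr_ge0.
elim: m => [|m IH]; first by rewrite big_ord0 expr0; lra.
by rewrite big_ord_recr/= IH exprS; lra.
Qed.

Section gliding_hump.
Context {R : realType} {X : normedModType R}.

(* Otherwise, along a sparse subsequence [s], the almost biorthogonal family
   [g (s i)], [y (s k) - lim y] makes the functional [\sum_i g (s i)] stay away from
   [0] on [y (s k) - lim y], although it vanishes at their weak cluster points. *)
Lemma weakly_compact_diagonal (A : set X) (g : nat -> dual_space X)
    (y : nat -> X) (B : R) :
  relatively_weakly_compact A -> (forall n, A (y n)) ->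
  (forall N x, \sum_(i < N) `|g i x| <= B * `|x|) ->
  g n (y n) @[n --> \oo] --> (0 : R).
Proof.
move=> cA Ay gB; apply: cvg_ultra => U UU ooU.
apply/cvgrPdist_lt => e e0; apply: contrapT => nU.
have {nU} Ue : \forall n \near U, e <= `|g n (y n)|.
  have [//|] := in_ultra_setVsetC [set n | `|0 - g n (y n)| < e] UU.
  by apply: filterS => n /= /negP; rewrite -leNgt sub0r normrN.
have [w wP] := ultra_weak_lim UU cA Ay.
pose z n := y n - w.
have gx0 x : g n x @[n --> \oo] --> (0 : R).
  by apply/norm_cvg0P; apply: bounded_sum_cvg0 => // N; exact: gB.
have zU (f : dual_space X) : f (z n) @[n --> U] --> (0 : R).
  rewrite -(subrr (f w)) /z.
  rewrite (_ : (fun n => f (y n - w)) = (fun n => f (y n) - f w)); last first.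
    by apply/funext => n; rewrite linearB.
  by apply: cvgB; [exact: wP|exact: cvg_cst].
(* Replacing [y n] by [z n] costs at most [d], which leaves [e / 2] on the diagonal; the
   off-diagonal terms total at most [2 * d = e / 8], which leaves more than [e / 4]. *)
pose d := e / 16.
have d0 : 0 < d by rewrite /d; lra.
pose small k (r : R) := `|r| <= d * 2^-1 ^+ k.
have smallP (F : set_system nat) (u : nat -> R) k : Filter F ->
    u @ F --> (0 : R) -> \forall n \near F, small k (u n).
  move=> FF /cvgrPdist_le /(_ (d * 2^-1 ^+ k)).
  rewrite mulr_gt0 ?exprn_gt0 ?invr_gt0// => /(_ isT).
  by apply: filterS => n; rewrite sub0r normrN.
pose P (t : seq nat) n := e / 2 <= `|g n (z n)| /\ forall i, (i < size t)%N ->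
  [/\ (nth 0%N t i < n)%N, small (size t) (g (nth 0%N t i) (z n)) &
      small (size t) (g n (z (nth 0%N t i)))].
have /history_choice[s sP] : forall t, exists n, P t n.
  move=> t.
  have Uge : \forall n \near U, e / 2 <= `|g n (z n)|.
    have gw : \forall n \near U, small 0%N (g n w).
      by apply: smallP; exact: (cvg_subfilter ooU (gx0 w)).
    apply: (filterS2 _ _ Ue gw) => n; rewrite /small expr0 mulr1 /z /d linearB/=.
    have := ler_normB (g n (y n) - g n w) (- g n w).
    by rewrite normrN opprK subrK; lra.
  have Usmall : \forall n \near U, forall i, (i < size t)%N ->
    [/\ (nth 0%N t i < n)%N, small (size t) (g (nth 0%N t i) (z n)) &
      small (size t) (g n (z (nth 0%N t i)))].
    apply: near_forall_lt => i.
    have U1 : \forall n \near U, (nth 0%N t i < n)%N.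
      by apply: ooU; exists (nth 0%N t i).+1.
    have U2 : \forall n \near U, small (size t) (g (nth 0%N t i) (z n)).
      by apply: smallP; exact: zU.
    have U3 : \forall n \near U, small (size t) (g n (z (nth 0%N t i))).
      by apply: smallP; exact: (cvg_subfilter ooU (gx0 _)).
    by apply: (filterS3 _ _ U1 U2 U3) => n.
  by have [n [n1 n2]] := filter_ex (filterI Uge Usmall); exists n.
have {sP}[ge sS sm] : [/\ forall k, e / 2 <= `|g (s k) (z (s k))|,
    forall k, (s k < s k.+1)%N &
    forall i k, i != k -> `|g (s i) (z (s k))| <= d * 2^-1 ^+ maxn i k].
  have sP' k i : (i < k)%N -> [/\ (s i < s k)%N, small k (g (s i) (z (s k))) &
      small k (g (s k) (z (s i)))].
    move=> ik; have [_ /(_ i)] := sP k.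
    by rewrite size_mkseq nth_mkseq// => /(_ ik).
  split=> [k|k|i k]; first by have [] := sP k.
    by have [] := sP' k.+1 k (ltnSn k).
  rewrite neq_ltn => /orP[ik|ki].
    by have [_ + _] := sP' k i ik; rewrite (maxn_idPr (ltnW ik)).
  by have [_ _] := sP' i k ki; rewrite (maxn_idPl (ltnW ki)).
have gsB m x : \sum_(i < m) `|g (s i) x| <= B * `|x|.
  suff : \sum_(i < m) `|g (s i) x| <= \sum_(j < s m) `|g j x|.
    by move=> /le_trans; apply; exact: gB.
  elim: m => [|m IH]; first by rewrite big_ord0 sumr_ge0.
  rewrite big_ord_recr/=; apply: (@le_trans _ _ (\sum_(j < (s m).+1) `|g j x|)).
    by rewrite big_ord_recr/= lerD2r.
  rewrite -!(big_mkord xpredT (fun j => `|g j x|)).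
  by rewrite (@big_cat_nat _ _ _ (s m).+1 0 (s m.+1))//= lerDl sumr_ge0.
pose G m : dual_space X := \sum_(i < m) g (s i).
have GE m x : G m x = \sum_(i < m) g (s i) x.
  have := dual_sumE m (fun=> 1) (g \o s) x.
  by under eq_bigr do rewrite scale1r; under [RHS]eq_bigr do rewrite mul1r.
have GB m : `|G m| <= `|B|.
  apply: dual_norm_bound => // x; rewrite GE (le_trans (ler_norm_sum _ _ _))//.
  by rewrite (le_trans (gsB m x))// ler_wpM2r// ler_norm.
have [G' G'P] := ultra_dual_lim UU GB.
(* [w'] may differ from [w], since [s] moves the ultrafilter. By the off-diagonal decay every
   [g (s j)] vanishes at [w' - w], and so does [G']. *)
have [w' w'P] := ultra_weak_lim UU cA (fun k => Ay (s k)).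
have zw' (f : dual_space X) : f (z (s k)) @[k --> U] --> f (w' - w).
  rewrite (_ : (fun k => f (z (s k))) = (fun k => f (y (s k)) - f w)); last first.
    by apply/funext => n; rewrite /z linearB.
  by rewrite linearB; apply: cvgB; [exact: w'P|exact: cvg_cst].
have gw' j : g (s j) (w' - w) = 0.
  apply: (cvg_unique _ (zw' (g (s j)))) => //.
  apply: (cvg_subfilter ooU).
  apply/norm_cvg0P; apply: (@squeeze_cvgr _ _ _ _ (fun=> 0) (fun k => d * 2^-1 ^+ k)).
  - exists j.+1 => // k jk; rewrite normr_ge0/=.
    by have := sm j k; rewrite (maxn_idPr (ltnW jk)); apply; rewrite neq_ltn jk.
  - exact: cvg_cst.
  - rewrite -(mulr0 d); apply: cvgMr; apply: cvg_expr.
    by rewrite ger0_norm ?invr_ge0// invf_lt1// ltr1n.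
have G'w' : G' (w' - w) = 0.
  apply: (cvg_unique _ (G'P (w' - w))) => //.
  rewrite (_ : (fun m => G m (w' - w)) = cst 0); first exact: cvg_cst.
  by apply/funext => m; rewrite GE big1.
have Gz k : e / 4 <= `|G' (z (s k))|.
  apply: (cvgr_to_ge (cvg_norm (G'P (z (s k))))).
  apply: ooU; exists k.+1 => // m /= km; rewrite GE (bigD1 (Ordinal km))//=.
  set S := \sum_(i < m | _) _.
  have : `|S| <= d * 2.
    rewrite (le_trans (ler_norm_sum _ _ _))//.
    apply: (@le_trans _ _ (\sum_(i < m) d * 2^-1 ^+ i)); last first.
      by rewrite -mulr_sumr ler_pM2l// sum_half_le.
    rewrite [leRHS](bigID (fun i => i != Ordinal km))/=.
    apply: (@le_trans _ _ (\sum_(i < m | i != Ordinal km) d * 2^-1 ^+ i)).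
      apply: ler_sum => i ik; rewrite (le_trans (sm i k ik))// ler_pM2l//.
      by rewrite ler_wiXn2l ?invr_ge0// ?leq_maxl// invf_le1// ler1n.
    by rewrite lerDl sumr_ge0// => i _; rewrite mulr_ge0 ?exprn_ge0 ?invr_ge0 ?ltW.
  have := ler_normB (g (s k) (z (s k)) + S) S; rewrite addrK.
  have := ge k; rewrite /d; lra.
have : e / 4 <= `|G' (w' - w)|.
  by apply: (cvgr_to_ge (cvg_norm (zw' G'))); exact: nearW.
by rewrite G'w' normr0; lra.
Qed.

End gliding_hump.

(** * Disjoint sequences and relatively weakly compact sets *)

Section disjoint_sequences.
Context {R : realType} {E : banachLatticeType R}.
Implicit Types (x y z u v : E) (f : dual_space E).

Lemma lsum_ge0 (z : nat -> E) (N : nat) : (forall i, 0 <=l z i) ->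
  0 <=l \sum_(i < N) z i.
Proof.
move=> z0; elim: N => [|N IH]; first by rewrite big_ord0 llexx.
by rewrite big_ord_recr/= laddr_ge0.
Qed.

(** The induction also carries that a partial sum is disjoint from all later terms, so that adding
    the next one stays below [u]. *)
Lemma disjoint_sum_le (z : nat -> E) u (N : nat) :
  (forall i, 0 <=l z i) -> (forall i, z i <=l u) ->
  (forall i j, i != j -> lmeet (z i) (z j) = 0) ->
  \sum_(i < N) z i <=l u.
Proof.
move=> z0 zu zd; suff [] : \sum_(i < N) z i <=l u /\
    forall m, (N <= m)%N -> lmeet (\sum_(i < N) z i) (z m) = 0 by [].
elim: N => [|N [IHu IHd]].
  rewrite big_ord0; split=> [|m _]; first exact: lle_transi (z0 0%N) (zu 0%N).
  apply: lle_eq; first exact: lmeetl.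
  by apply: lmeet_ge0 => //; exact: llexx.
rewrite big_ord_recr/=; split=> [|m Nm].
  by apply: ladd_disjoint_le => //; exact: IHd.
apply: lmeetD_eq0 => //; first exact: lsum_ge0.
  by apply: IHd; exact: ltnW.
by apply: zd; rewrite ltn_eqF.
Qed.

(** Signs turn the sum into one value of [f], at a vector whose absolute value is at most the
    disjoint sum and hence at most [u]. *)
Lemma disjoint_sum_dual f (z : nat -> E) u (N : nat) :
  (forall i, 0 <=l z i) -> (forall i, z i <=l u) ->
  (forall i j, i != j -> lmeet (z i) (z j) = 0) ->
  \sum_(i < N) `|f (z i)| <= `|f| * `|u|.
Proof.
move=> z0 zu zd; pose s i : R := Num.sg (f (z i)).
have -> : \sum_(i < N) `|f (z i)| = f (\sum_(i < N) s i *: z i).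
  by rewrite linear_sum/=; apply: eq_bigr => i _; rewrite dualZ normrEsg.
rewrite (le_trans (ler_norm _))// (le_trans (dual_le _ _))// ler_wpM2l//.
apply: lnorm_le_abs; apply: lle_transi _ (disjoint_sum_le N z0 zu zd).
elim: N => [|n IH]; first by rewrite !big_ord0 labs_id llexx.
rewrite !big_ord_recr/=; apply: lle_transi (labsD _ _) _; apply: lleD => //.
rewrite labs_scale (labs_id (z0 n)) -[X in _ <=l X]scale1r.
by apply: lle_scalel => //; rewrite normr_sg lern1 leq_b1.
Qed.

Lemma disjoint_lpos (x : nat -> E) : disjoint_sequence x ->
  forall i j, i != j -> lmeet (lpos (x i)) (lpos (x j)) = 0.
Proof.
move=> dx i j ij; apply: lmeet_eq0 (dx i j ij); rewrite ?lpos_ge0//;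
  exact: lpos_labs.
Qed.

Lemma disjointN (x : nat -> E) : disjoint_sequence x ->
  disjoint_sequence (fun i => - x i).
Proof. by move=> dx i j ij; rewrite !labsN; exact: dx. Qed.

Lemma order_bounded_disjoint_weakly_null (x : nat -> E) u :
  disjoint_sequence x -> (forall n, labs (x n) <=l u) -> weakly_null x.
Proof.
move=> dx xu; apply/weakly_nullP => f.
have pos (z : nat -> E) : disjoint_sequence z -> (forall n, labs (z n) <=l u) ->
    f (lpos (z n)) @[n --> \oo] --> (0 : R).
  move=> dz zu; apply/norm_cvg0P/(@bounded_sum_cvg0 _ _ (`|f| * `|u|)) => // N.
  apply: (@disjoint_sum_dual f (fun i => lpos (z i)) u N) => [i|i|].
  - exact: lpos_ge0.
  - by apply: lle_transi (zu i); exact: lpos_labs.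
  - exact: disjoint_lpos.
rewrite (_ : (fun n => _) = (fun n => f (lpos (x n)) - f (lpos (- x n)))).
  rewrite -(subrr (0 : R)); apply: cvgB; apply: pos => //; first exact: disjointN.
  by move=> n; rewrite labsN.
by apply/funext => n; rewrite -linearB -lpos_subN.
Qed.

Section ideal_seminorm.
Variables (f : dual_space E) (x : E).

(* The restriction of [|f|] to the ideal generated by [x], extended to [E] as a
   lattice seminorm. *)
Definition ideal_seminorm y : R :=
  sup [set `|f z| | z in [set z | [/\ 0 <=l z, z <=l labs y &
    exists2 k : R, 0 <= k & z <=l k *: labs x]]].

Let S y := [set `|f z| | z in [set z | [/\ 0 <=l z, z <=l labs y &
    exists2 k : R, 0 <= k & z <=l k *: labs x]]].

Let S_ub y : ubound (S y) (`|f| * `|y|).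
Proof.
move=> _ [z [z0 zy _] <-]; rewrite (le_trans (dual_le _ _))// ler_wpM2l//.
by apply: lnorm_mono; rewrite (labs_id z0).
Qed.

Let S_nonempty y : S y !=set0.
Proof.
exists `|f 0|, 0 => //; split; [exact: llexx|exact: labs_ge0|].
by exists 0 => //; rewrite scale0r llexx.
Qed.

Lemma ideal_seminorm_ge y z k : 0 <=l z -> z <=l labs y -> 0 <= k ->
  z <=l k *: labs x -> `|f z| <= ideal_seminorm y.
Proof.
move=> z0 zy k0 zk; apply: ub_le_sup; first by exists (`|f| * `|y|); exact: S_ub.
by exists z => //; split=> //; exists k.
Qed.

Lemma ideal_seminorm_le y (M : R) :
  (forall z k, 0 <=l z -> z <=l labs y -> 0 <= k -> z <=l k *: labs x ->
    `|f z| <= M) -> ideal_seminorm y <= M.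
Proof.
move=> h; apply: ge_sup; first exact: S_nonempty.
by move=> _ [z [z0 zy [k k0 zk]] <-]; exact: h zk.
Qed.

Lemma ideal_seminorm_adherent y (e : R) : 0 < e -> exists z,
  [/\ 0 <=l z, z <=l labs y, exists2 k : R, 0 <= k & z <=l k *: labs x &
  ideal_seminorm y <= `|f z| + e].
Proof.
move=> e0; have Ss : has_sup (S y).
  by split; [exact: S_nonempty|exists (`|f| * `|y|); exact: S_ub].
have [_ [z [z0 zy kz] <-] ze] := sup_adherent e0 Ss.
by exists z; split=> //; rewrite -lerBlDr ltW.
Qed.

(** Subadditivity is Riesz decomposition: [z] below [labs y1 + labs y2] splits into
    [lmeet z (labs y1)] and a remainder below [labs y2], both in the ideal of [x]. *)
Lemma ideal_seminorm_sublinear : sublinear ideal_seminorm.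
Proof.
split.
  move=> y1 y2; apply: ideal_seminorm_le => z k z0 zy k0 zk.
  have z1z : lmeet z (labs y1) <=l z := lmeetl _ _.
  have z10 : 0 <=l lmeet z (labs y1) by apply: lmeet_ge0 => //; exact: labs_ge0.
  rewrite -[z in f z](subrK (lmeet z (labs y1))) addrC linearD.
  rewrite (le_trans (ler_normD _ _))// lerD//.
    apply: (@ideal_seminorm_ge _ _ k) => //; first exact: lmeetr.
    exact: lle_transi zk.
  apply: (@ideal_seminorm_ge _ _ k) => //; first by rewrite lsub_ge0.
    rewrite lle_subl addrC -lle_subl llexI; apply/andP; split.
      by rewrite lle_subl -{1}[z]addr0 lleD ?llexx ?labs_ge0.
    by rewrite lle_subl; exact: lle_transi (labsD _ _).
  by apply: lle_transi _ zk; rewrite lle_subl -{1}[z]addr0 lleD ?llexx.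
have leZ (a : R) y : 0 < a -> ideal_seminorm (a *: y) <= a * ideal_seminorm y.
  move=> a0; apply: ideal_seminorm_le => z k z0 zy k0 zk.
  have ai : 0 <= a^-1 by rewrite invr_ge0 ltW.
  have -> : z = a *: (a^-1 *: z) by rewrite scalerA mulfV ?gt_eqF// scale1r.
  rewrite dualZ normrM gtr0_norm// ler_pM2l//.
  apply: (@ideal_seminorm_ge _ _ (a^-1 * k)); last 2 first.
  - exact: mulr_ge0.
  - by rewrite -scalerA; exact: lle_scale.
  - exact: lscale_ge0.
  have := lle_scale ai zy.
  by rewrite labs_scale gtr0_norm// scalerA mulVf ?gt_eqF// scale1r.
move=> a y; rewrite le_eqVlt => /predU1P[<-|a0].
  rewrite scale0r mul0r; apply/eqP; rewrite eq_le; apply/andP; split.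
    apply: ideal_seminorm_le => z k z0; rewrite labs_id ?llexx// => zle _ _.
    by rewrite (lle_eq zle z0) linear0 normr0.
  rewrite -(normr0 R) -(linear0 f).
  by apply: (@ideal_seminorm_ge _ _ 0); rewrite ?labs_ge0 ?llexx// scale0r llexx.
apply/eqP; rewrite eq_le leZ//= -ler_pdivlMl//.
have := leZ a^-1 (a *: y); rewrite invr_gt0 => /(_ a0).
by rewrite scalerA mulVf ?gt_eqF// scale1r.
Qed.

Lemma ideal_seminormN y : ideal_seminorm (- y) = ideal_seminorm y.
Proof. by rewrite /ideal_seminorm labsN. Qed.

Lemma ideal_seminorm_dual y : labs x <=l labs y ->
  `|f x| <= ideal_seminorm y + ideal_seminorm y.
Proof.
move=> xy; rewrite [x in f x]lpos_subN linearB (le_trans (ler_normB _ _))// lerD//.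
  apply: (@ideal_seminorm_ge _ _ 1); rewrite ?lpos_ge0 ?scale1r ?lpos_labs//.
  exact: lle_transi (lpos_labs _) xy.
apply: (@ideal_seminorm_ge _ _ 1); rewrite ?lpos_ge0 ?scale1r ?lposN_labs//.
exact: lle_transi (lposN_labs _) xy.
Qed.

End ideal_seminorm.

(** Almost maximising vectors for the seminorms lie in ideals of disjoint elements, so they are
    disjoint, and all lie below [labs y]. *)
Lemma sum_ideal_seminorm f (x : nat -> E) y (N : nat) : disjoint_sequence x ->
  \sum_(n < N) ideal_seminorm f (x n) y <= `|f| * `|y|.
Proof.
move=> dx; apply/ler_addgt0Pr => e e0.
have d0 : 0 < e / N.+1%:R by rewrite divr_gt0.
have /choice[z zP] := fun n => ideal_seminorm_adherent f (x n) y d0.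
apply: (@le_trans _ _ (\sum_(n < N) (`|f (z n)| + e / N.+1%:R))).
  by apply: ler_sum => n _; have [] := zP n.
rewrite big_split/= lerD//.
  rewrite -(norm_labs y); apply: disjoint_sum_dual => [i|i|i j ij].
  - by have [] := zP i.
  - by have [] := zP i.
  - have [zi0 _ [k k0 zik] _] := zP i; have [zj0 _ [l l0 zjl] _] := zP j.
    apply: (lmeet_eq0 zi0 zj0 zik zjl).
    by apply: lmeet_scale_eq0 => //; rewrite ?labs_ge0//; exact: dx.
rewrite sumr_const card_ord -[_ *+ N]mulr_natr -mulrA ler_piMr ?(ltW e0)//.
by rewrite mulrC ler_pdivrMr// mul1r ler_nat.
Qed.

Lemma relatively_weakly_compact_disjoint (A : set E) :
  relatively_weakly_compact A -> disjointly_weakly_compact A.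
Proof.
move=> cA; split; first exact: relatively_weakly_compact_bounded.
move=> x dx xA; apply/weakly_nullP => f.
have /choice[y yP] : forall n, exists y, A y /\ labs (x n) <=l labs y.
  by move=> n; have [y Ay xy] := xA n; exists y.
pose p n := ideal_seminorm f (x n).
have pB n z : p n z <= `|f| * `|z|.
  have := sum_ideal_seminorm f z n.+1 dx; rewrite big_ord_recr/=; apply: le_trans.
  rewrite lerDr; apply: sumr_ge0 => i _.
  have := sublinear_ge z (ideal_seminorm_sublinear f (x i)).
  by rewrite ideal_seminormN; lra.
have /choice[g gP] : forall n, exists g : dual_space E,
    (forall z, `|g z| <= p n z) /\ g (y n) = p n (y n).
  move=> n; have [g [lg gp gy]] :=
    hahn_banach (y n) (ideal_seminorm_sublinear f (x n)).
  have gN z : `|g z| <= p n z.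
    rewrite ler_norml gp andbT lerNl /p -ideal_seminormN.
    have := lg (-1) z 0; have := lg 1 0 0; rewrite scale1r addr0 -[LHS]add0r.
    move=> /addIr; rewrite scale1r => <-; rewrite !addr0 !scaleN1r => <-.
    exact: gp.
  have [h hg] := mk_dual lg (fun z => le_trans (gN z) (pB n z)).
  by exists h; rewrite hg.
have gy0 : g n (y n) @[n --> \oo] --> (0 : R).
  apply: (weakly_compact_diagonal cA (fun n => (yP n).1) (B := `|f|)) => N z.
  apply: le_trans (sum_ideal_seminorm f z N dx).
  by apply: ler_sum => i _; have [] := gP i.
apply/norm_cvg0P.
apply: (@squeeze_cvgr _ _ _ _ (fun=> 0) (fun n => g n (y n) + g n (y n))).
- apply: nearW => n; rewrite normr_ge0/=; have [_ ->] := gP n.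
  by apply: ideal_seminorm_dual; have [] := yP n.
- exact: cvg_cst.
- by rewrite -(addr0 0); exact: cvgD.
Qed.

End disjoint_sequences.

(** * Approximate domination by an order interval *)

Section domination.
Context {R : realType} {E : banachLatticeType R}.
Implicit Types (x y z u v : E).

(** The second difference is a negative multiple of the first, so the two positive parts are, up to
    scaling, those of [t] and [- t]. *)
Lemma lpos_disjoint x y (a c : R) : 0 <= a -> 0 <= c -> a * c = 1 ->
  lmeet (lpos (x - a *: y)) (lpos (y - c *: x)) = 0.
Proof.
move=> a0 c0 ac; have -> : y - c *: x = c *: - (x - a *: y).
  by rewrite opprB scalerBr scalerA mulrC ac scale1r.
set t := x - a *: y.
apply: (@lmeet_eq0 _ _ _ _ (1 *: lpos t) (c *: lpos (- t))).
- exact: lpos_ge0.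
- exact: lpos_ge0.
- by rewrite scale1r llexx.
- exact: lpos_scale.
- apply: lmeet_scale_eq0 => //; [exact: lpos_ge0..|exact: lmeet_lpos].
Qed.

(* Disjointification: if no [u] worked there would be [x k] in [A] with
   [f n ((|x k| - 4^k \sum_(i < k) |x i|)^+)] bounded away from [0]; subtracting
   [2^-k \sum_i 2^-i |x i|] makes these positive parts disjoint. *)
Lemma disjoint_domination (A : set E) (f : nat -> dual_space E) (M e : R) :
  bounded_set A -> (forall n, `|f n| <= M) ->
  (forall v : nat -> E, disjoint_sequence v -> (forall k, Sol A (v k)) ->
    forall d : R, 0 < d -> \forall k \near \oo, forall n, `|f n (v k)| <= d) ->
  0 < e -> exists2 u, 0 <=l u &
    forall x, A x -> forall n, `|f n (lpos (labs x - u))| <= e.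
Proof.
move=> /bounded_setP[r Ar] fM fv e0; apply: contrapT => noU.
pose P (l : seq E) x := A x /\ exists n,
  e < `|f n (lpos (labs x - 4 ^+ size l *: \sum_(z <- l) labs z))|.
have /history_choice[x xP] : forall l, exists x, P l x.
  move=> l; apply: contrapT => nP; apply: noU.
  exists (4 ^+ size l *: \sum_(z <- l) labs z).
    apply: lscale_ge0; first by rewrite exprn_ge0.
    elim: l {nP} => [|z l IH]; first by rewrite big_nil llexx.
    by rewrite big_cons laddr_ge0 ?labs_ge0.
  move=> x Ax n; rewrite leNgt; apply/negP => lt.
  by apply: nP; exists x; split=> //; exists n.
have Ax k : A (x k) by have [] := xP k.
pose b k := 4 ^+ k *: \sum_(i < k) labs (x i).
pose w k := lpos (labs (x k) - b k).
have wP k : exists n, e < `|f n (w k)|.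
  have [_ [n fn]] := xP k; exists n.
  move: fn; rewrite size_mkseq /mkseq big_map.
  by rewrite -[k in iota _ k]subn0 -/(index_iota 0 k) big_mkord.
have h0 (k : nat) : 0 <= 2^-1 ^+ k :> R by rewrite exprn_ge0 ?invr_ge0.
pose t k : E := 2^-1 ^+ k *: labs (x k).
have t0 k : 0 <=l t k by apply: lscale_ge0 => //; exact: labs_ge0.
have /cvg_ex[y ty] : cvgn (series t).
  apply: normed_cvg; rewrite /normed_series_of; apply: nondecreasing_is_cvgn.
    by apply/nondecreasing_seqP => n; rewrite !seriesEnat/= big_nat_recr//= lerDl.
  exists (2 * r) => _ [n _ <-]; rewrite seriesEnat/= big_mkord.
  have r0 : 0 <= r := le_trans (normr_ge0 _) (Ar _ (Ax 0%N)).
  apply: le_trans (ler_wpM2r r0 (@sum_half_le R n)); rewrite mulr_suml.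
  apply: ler_sum => i _; rewrite normrZ norm_labs ger0_norm// ler_wpM2l//.
  exact: Ar.
have t_y k : t k <=l y.
  rewrite -lsub_ge0; apply: (@lim_lge0 _ _ (fun n => series t n - t k)).
    exists k.+1 => // n /= kn; rewrite lsub_ge0 seriesEnat/= big_mkord.
    rewrite (bigD1 (Ordinal kn))//= -[X in X <=l _]addr0 lleD ?llexx//.
    elim/big_ind : _ => [|a c|i _]; [exact: llexx|exact: laddr_ge0|exact: t0].
  by apply: cvgB => //; exact: cvg_cst.
have y0 : 0 <=l y := lle_transi (t0 0%N) (t_y 0%N).
pose v k := lpos (labs (x k) - b k - 2^-1 ^+ k *: y).
have hy k : 0 <=l 2^-1 ^+ k *: y by exact: lscale_ge0.
have b0 k : 0 <=l b k.
  apply: lscale_ge0; first exact: exprn_ge0.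
  by apply: (lsum_ge0 (z := fun i => labs (x i))) => i; exact: labs_ge0.
have subl (a c : E) : 0 <=l c -> a - c <=l a.
  by move=> c0; rewrite lle_subl -{1}[a]addr0 lleD ?llexx.
have vx k : v k <=l labs (x k).
  rewrite lpos_le labs_ge0 andbT.
  by apply: lle_transi (subl _ _ (hy k)) _; exact: subl.
have vA k : Sol A (v k).
  by exists (x k) => //; rewrite labs_id// lpos_ge0.
have vd0 i j : (i < j)%N -> lmeet (v i) (v j) = 0.
  move=> ij.
  (* The factors [2^-1 ^+ (i + j)] and [2 ^+ (i + j)] are inverse, as [lpos_disjoint] requires. The
     first comes from [y] dominating [t j]; the second from [b j] dominating [4 ^+ j *: labs (x i)]
     with [i < j]. *)
  apply: (@lmeet_eq0 _ _ _ _ (lpos (labs (x i) - 2^-1 ^+ (i + j) *: labs (x j)))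
    (lpos (labs (x j) - 2 ^+ (i + j) *: labs (x i)))); rewrite ?lpos_ge0//.
  - apply: lpos_mono; apply: lleD; first exact: subl.
    by rewrite lleN2 exprD -scalerA; exact: lle_scale (t_y j).
  - apply: lpos_mono; apply: lle_transi (subl _ _ (hy j)) _.
    apply: lleD; [exact: llexx|rewrite lleN2].
    apply: (@lle_transi _ _ _ (4 ^+ j *: labs (x i))).
      apply: lle_scalel (labs_ge0 _).
      rewrite (_ : 4 = 2 * 2) ?exprMn -?exprD; last by rewrite -natrM.
      by rewrite ler_weXn2l ?ler1n// leq_add2r ltnW.
    apply: lle_scale; first exact: exprn_ge0.
    rewrite (bigD1 (Ordinal ij))//= -[X in X <=l _]addr0 lleD ?llexx//.
    by elim/big_ind : _ => [|a c|k _]; [exact: llexx|exact: laddr_ge0|exact: labs_ge0].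
  - apply: lpos_disjoint; rewrite ?exprn_ge0//.
    by rewrite -exprMn mulVf ?expr1n.
have vd : disjoint_sequence v.
  move=> i j; rewrite !labs_id ?lpos_ge0// neq_ltn => /orP[ij|ji].
    exact: vd0.
  by rewrite lmeetC; exact: vd0.
have wv k : `|w k - v k| <= 2^-1 ^+ k * `|y|.
  rewrite -[X in X * _]ger0_norm// -normrZ; apply: lnorm_le_abs.
  by rewrite labs_id ?lpos_part_le// lsub_ge0; apply: lpos_mono; exact: subl.
have e20 : 0 < e / 2 by rewrite divr_gt0.
have hM : 2^-1 ^+ k * (M * `|y|) @[k --> \oo] --> (0 : R).
  rewrite -(mul0r (M * `|y|)); apply: cvgMl; apply: cvg_expr.
  by rewrite ger0_norm ?invr_ge0// invf_lt1// ltr1n.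
have /cvgrPdist_le/(_ _ e20) hMe := hM.
have [k [fvk]] := filter_ex (filterI (fv v vd vA _ e20) hMe).
rewrite /= sub0r normrN => /(le_trans (ler_norm _)) Mk.
have [n] := wP k; apply/negP; rewrite -leNgt.
have M0 : 0 <= M := le_trans (normr_ge0 _) (fM n).
have := dual_le (f n) (w k - v k); rewrite linearB.
have : `|f n| * `|w k - v k| <= M * (2^-1 ^+ k * `|y|).
  by apply: ler_pM.
have := fvk n; have := ler_normD (f n (w k) - f n (v k)) (f n (v k)).
by rewrite subrK; move: Mk; rewrite mulrCA; lra.
Qed.

End domination.

(** * Operators into c0 *)

Section c0_dual.
Context {R : realType}.
Implicit Types (u : c0 R) (g : dual_space (c0 R)).

Let cut_c0 (N : nat) (c : nat -> R) :
  (fun n => if (n < N)%N then c n else 0) \in c0_pred.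
Proof.
apply/c0_predP; apply: cvg_near_cst; exists N => // n /= Nn.
by rewrite ltnNge Nn.
Qed.

(** Takes any real sequence, in particular sequences of signs that do not tend to 0. *)
Definition c0_cut N c : c0 R := C0 (cut_c0 N c).

Definition c0_basis (i : nat) : c0 R := c0_cut i.+1 (fun n => (n == i)%:R).

Lemma dual_c0_cut g N c :
  g (c0_cut N c) = \sum_(i < N) c i * g (c0_basis i).
Proof.
elim: N => [|N IH].
  rewrite big_ord0 -(linear0 g); congr (g _).
  by apply/val_inj/funext => n.
rewrite big_ord_recr/= -IH -dualZ -linearD; congr (g _).
apply/val_inj/funext => n.
rewrite [RHS](_ : _ = (if (n < N)%N then c n else 0) +
  c N * (if (n < N.+1)%N then (n == N)%:R else 0))//= ltnS.
by case: ltngtP => [nN|nN|->]; rewrite ?mulr0 ?addr0 ?add0r ?mulr1.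
Qed.

(** Functionals on [c0] are summable sequences: the cut sign sequence has norm at most 1 and [g]
    attains the sum on it. *)
Lemma dual_c0_sum g N : \sum_(i < N) `|g (c0_basis i)| <= `|g|.
Proof.
pose c i := Num.sg (g (c0_basis i)).
have -> : \sum_(i < N) `|g (c0_basis i)| = g (c0_cut N c).
  by rewrite dual_c0_cut; apply: eq_bigr => i _; rewrite normrEsg.
rewrite (le_trans (ler_norm _))// (le_trans (dual_le _ _))// ler_piMr//.
apply: c0_norm_le => n /=; case: ifP => _; last by rewrite normr0.
by rewrite normr_sg lern1 leq_b1.
Qed.

Lemma c0_cut_norm u (e : R) : 0 < e ->
  \forall N \near \oo, `|u - c0_cut N u| <= e.
Proof.
move=> e0; have /cvgr0Pnorm_le/(_ e e0)[N _ uN] := c0_cvg u.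
exists N => // m /= Nm; apply: c0_norm_le => n.
rewrite [X in `|X|](_ : _ = u n - (if (n < m)%N then u n else 0))//.
have [nm|mn] := ltnP; first by rewrite subrr normr0 ltW.
by rewrite subr0 uN//=; exact: leq_trans mn.
Qed.

(** [N] is taken so that the coefficients of [g] beyond it sum to at most [d], hence independently
    of [u]; density of the cuts extends the estimate to all of [c0]. *)
Lemma dual_c0_tail g (d : R) : 0 < d -> exists N, forall u,
  `|g u - \sum_(i < N) u i * g (c0_basis i)| <= d * `|u|.
Proof.
move=> d0; pose s N := \sum_(i < N) `|g (c0_basis i)|.
have ss : has_sup (range s).
  by split; [exists (s 0%N), 0%N|exists `|g| => _ [N _ <-]; exact: dual_c0_sum].
have [_ [N _ <-] sN] := sup_adherent d0 ss.
have tail m : (N <= m)%N -> s m - s N <= d.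
  move=> Nm; have : s m <= sup (range s) by apply: sup_upper_bound => //; exists m.
  by move: sN; lra.
exists N => u; apply/ler_addgt0Pr => e e0.
have e'0 : 0 < e / (`|g| + 1) by rewrite divr_gt0// ltr_wpDl.
have [m [um Nm]] := filter_ex (filterI (c0_cut_norm u e'0) (nbhs_infty_ge N)).
have h1 : `|g u - g (c0_cut m u)| <= e.
  rewrite -linearB (le_trans (dual_le _ _))//.
  rewrite (le_trans (ler_wpM2l _ um))// mulrA ler_pdivrMr ?ltr_wpDl//.
  by rewrite mulrC ler_pM2l// lerDl.
have h2 : `|g (c0_cut m u) - \sum_(i < N) u i * g (c0_basis i)| <= d * `|u|.
  rewrite dual_c0_cut -!(big_mkord xpredT (fun i => u i * g (c0_basis i))).
  rewrite (@big_cat_nat _ _ _ N 0 m)//= addrAC subrr add0r.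
  rewrite (le_trans (ler_norm_sum _ _ _))//.
  apply: (@le_trans _ _ ((s m - s N) * `|u|)); last by rewrite ler_wpM2r// tail.
  rewrite /s -!(big_mkord xpredT (fun i => `|g (c0_basis i)|)).
  rewrite [X in (X - _) * _](@big_cat_nat _ _ _ N 0 m)//= addrAC subrr add0r.
  rewrite mulr_suml; apply: ler_sum => i _; rewrite normrM mulrC ler_wpM2l//.
  exact: c0_norm_ub.
by move: h1 h2; rewrite !ler_norml; lra.
Qed.

End c0_dual.

Section c0_operator.
Context {R : realType} {X : normedModType R}.

Lemma weakly_null_operator (f : nat -> dual_space X) : weakly_null f ->
  exists T : {linear X -> c0 R}, forall x n, T x n = f n x.
Proof.
move=> f0.
have fc0 x : (fun n => f n x) \in c0_pred.
  apply/c0_predP; have [phi phiE] := bidual_eval x.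
  by rewrite -(funext (fun n => phiE (f n))); move/weakly_nullP : f0; exact.
pose T x : c0 R := C0 (fc0 x).
have lT : linear T.
  by move=> a x y; apply/val_inj/funext => n; exact: dual_linear.
pose LT : {linear X -> c0 R} := HB.pack T (GRing.isLinear.Build R X (c0 R) _ T lT).
by exists LT.
Qed.

Lemma weakly_null_operator_weakly_compact (f : nat -> dual_space X)
    (T : {linear X -> c0 R}) :
  weakly_null f -> (forall x n, T x n = f n x) -> weakly_compact_operator T.
Proof.
move=> f0 TE; have [M fM] := weakly_null_bounded f0.
have M0 : 0 <= M := le_trans (normr_ge0 _) (fM 0%N).
have T_le x : `|T x| <= M * `|x|.
  apply: c0_norm_le => n; rewrite TE (le_trans (dual_le _ _))//.
  by rewrite ler_wpM2r.
split=> [r|A /bounded_setP[r Ar]].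
  by exists (M * r) => x xr; rewrite (le_trans (T_le x))// ler_wpM2l.
pose K := [set u : c0 R | exists2 phi : dual_space (dual_space X),
  `|phi| <= `|r| & forall n, u n = phi (f n)].
have uM u : K u -> `|u| <= `|r| * M.
  move=> [phi phir uE]; apply: c0_norm_le => n.
  by rewrite uE (le_trans (dual_le _ _))// ler_pM.
apply: (@precompact_subset (weak_space (c0 R)) _ K).
  move=> _ [x Ax <-]; have [phi phiE] := bidual_eval x.
  exists phi => [|n]; last by rewrite phiE TE.
  apply: dual_norm_bound => // h; rewrite phiE (le_trans (dual_le _ _))//.
  by rewrite mulrC ler_wpM2r// (le_trans (Ar x Ax))// ler_norm.
apply: relatively_weakly_compact_ultra => F FU FK.
(* [s u] represents [u] by a functional in the ball; off [K] it is 0, so that the bound holds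
   everywhere. *)
have /choice[s sP] : forall u, exists phi : dual_space (dual_space X),
    `|phi| <= `|r| /\ (K u -> forall n, u n = phi (f n)).
  move=> u; have [[phi phir uE]|nK] := pselect (K u); first by exists phi.
  by exists 0; rewrite normr0.
have sr u : `|s u| <= `|r| by have [] := sP u.
have [phi phiP] := ultra_dual_lim FU sr.
have yc0 : (fun n => phi (f n)) \in c0_pred.
  by apply/c0_predP; move/weakly_nullP : f0; exact.
pose y : c0 R := C0 yc0.
have Ky : K y.
  exists phi => //; apply: dual_norm_bound => // h.
  apply: (cvgr_to_le (cvg_norm (phiP h))); apply: nearW => u.
  by rewrite (le_trans (dual_le _ _))// ler_wpM2r.
exists y => // g; apply/cvgrPdist_le => e e0.
pose B := `|r| * M + 1; have B0 : 0 < B by rewrite ltr_wpDl// mulr_ge0.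
have d0 : 0 < e / 3 / B by rewrite !divr_gt0.
have [N gN] := dual_c0_tail g d0.
pose S (u : c0 R) := \sum_(i < N) u i * g (c0_basis i).
have gS u : K u -> `|g u - S u| <= e / 3.
  move=> /uM Ku; rewrite (le_trans (gN u))// mulrAC ler_pdivrMr// ler_pM2l.
    by rewrite (le_trans Ku)// lerDl.
  by rewrite divr_gt0.
have SF : \forall u \near F, `|S y - S u| <= e / 3.
  have coord i : u i @[u --> F] --> y i.
    have us : \forall u \near F, s u (f i) = u i.
      by apply: filterS FK => u Ku; have [_ /(_ Ku i) ->] := sP u.
    exact: cvg_trans (near_eq_cvg us) (phiP (f i)).
  have : S u @[u --> F] --> S y.
    apply: cvg_big => [|i _]; first exact: add_continuous.
    by apply: cvgM; [exact: coord|exact: cvg_cst].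
  by move/cvgrPdist_le; apply; rewrite divr_gt0.
apply: filterS (filterI FK SF) => u [/gS + +]; have := gS y Ky.
by rewrite !ler_norml; lra.
Qed.

(** The tail of one [u] controls a whole ball around it, and compactness makes the index uniform. *)
Lemma c0_precompact_tail (B : set (c0 R)) (e : R) : precompact B -> 0 < e ->
  \forall n \near \oo, forall u, B u -> `|u n| <= e.
Proof.
move=> [K BK [/compact_near_coveringP cK _]] e0.
have e20 : 0 < e / 2 by rewrite divr_gt0.
have : \forall n \near \oo, K `<=` (fun u : c0 R => `|u n| <= e).
  apply: (cK _ _ (fun n (u : c0 R) => `|u n| <= e)) => u _.
  have /cvgr0Pnorm_le/(_ _ e20)[N _ uN] := c0_cvg u.
  exists (ball u (e / 2), [set n | (N <= n)%N]) => /=.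
    by split; [exact: nbhsx_ballx|exists N].
  move=> [v n] [/= uv Nn]; move: uv; rewrite -ball_normE/= => /ltW uv.
  have := le_trans (c0_norm_ub (u - v) n) uv; have := uN n Nn.
  rewrite [(u - v) n](_ : _ = u n - v n)// !ler_norml; lra.
by apply: filterS => n Kn u /BK; exact: Kn.
Qed.

End c0_operator.

(** * The (d)-DP property *)

Section dDP.
Context {R : realType} {E : banachLatticeType R}.

Lemma order_interval_disjointly_weakly_compact (a b : E) :
  disjointly_weakly_compact (order_interval a b).
Proof.
have ab x : order_interval a b x -> labs x <=l labs a + labs b.
  move=> /andP[ax xb]; rewrite labs_le; apply/andP; split.
    rewrite -[x]add0r; apply: lleD; first exact: labs_ge0.
    exact: lle_transi xb (lle_labs b).
  rewrite -[- x]addr0; apply: lleD; last exact: labs_ge0.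
  by apply: lle_transi _ (lleN_labs a); rewrite lleN2.
split.
  by apply/bounded_setP; exists `|labs a + labs b| => x /ab; exact: lnorm_le_abs.
move=> u du uS.
apply: (@order_bounded_disjoint_weakly_null _ _ _ (labs a + labs b)) => // n.
by have [x /ab xab ux] := uS n; exact: lle_transi xab.
Qed.

Lemma d_DP_dunford_pettis : d_DP_property E ->
  dunford_pettis_property E /\
  forall a b : E, dunford_pettis_set (order_interval a b).
Proof.
move=> dDP; split=> [A cA|a b]; apply: dDP.
  exact: relatively_weakly_compact_disjoint.
exact: order_interval_disjointly_weakly_compact.
Qed.

(** The range of [v] is a Dunford-Pettis set, which settles all [n >= N] for every [k]; the finitely
    many remaining [n] use that [v] is weakly null. *)
Lemma dunford_pettis_weakly_null (v : nat -> E) (f : nat -> dual_space E) (d : R) :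
  dunford_pettis_property E -> weakly_null v -> weakly_null f -> 0 < d ->
  \forall k \near \oo, forall n, `|f n (v k)| <= d.
Proof.
move=> DP v0 f0 d0.
have /dunford_pettis_setP[_ /(_ f f0 d d0)[N _ fN]] := DP _ (weakly_null_rwc v0).
have : \forall k \near \oo, forall n, (n < N)%N -> `|f n (v k)| <= d.
  apply: near_forall_lt => n; move/weakly_nullP : v0 => /(_ (f n)).
  by move/cvgr0Pnorm_le; exact.
apply: filterS => k fk n; have [/fk//|Nn] := ltnP n N.
by apply: fN => //; exists k.
Qed.

Lemma dunford_pettis_d_DP : dunford_pettis_property E ->
  (forall a b : E, dunford_pettis_set (order_interval a b)) -> d_DP_property E.
Proof.
move=> DP DPi A [bA Av]; apply/dunford_pettis_setP; split=> // f f0 e e0.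
have [M fM] := weakly_null_bounded f0.
have bS : bounded_set (Sol A).
  have /bounded_setP[r Ar] := bA; apply/bounded_setP; exists r => y [x Ax yx].
  exact: le_trans (lnorm_mono yx) (Ar x Ax).
have SS x : Sol (Sol A) x -> Sol A x.
  by move=> [y [z Az yz] xy]; exists z => //; exact: lle_transi yz.
have e40 : 0 < e / 4 by rewrite divr_gt0.
(* Domination is applied to the solid hull of [A], so that it covers the positive and negative parts
   of each [x] in [A]. *)
have [u u0 uP] : exists2 u, 0 <=l u & forall x, Sol A x -> forall n,
    `|f n (lpos (labs x - u))| <= e / 4.
  apply: (disjoint_domination bS fM) => // v dv vA d d0.
  by apply: dunford_pettis_weakly_null => //; apply: Av => // k; exact: SS.
have /dunford_pettis_setP[_ /(_ f f0 _ e40)] := DPi 0 u.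
apply: filterS => n fn x Ax.
have pos z : 0 <=l z -> Sol A z -> `|f n z| <= e / 2.
  move=> z0 zA; have := uP z zA n; rewrite labs_id// => h.
  (* [z - lpos (z - u)] is the meet of [z] and [u], a point of the order interval from 0 to [u]. *)
  have : `|f n (z - lpos (z - u))| <= e / 4.
    apply: fn; apply/andP; split.
      by rewrite lsub_ge0 lpos_le z0 andbT lle_subl -{1}[z]addr0 lleD ?llexx.
    by rewrite lle_subl addrC -lle_subl lle_lpos.
  by move: h; rewrite linearB !ler_norml; lra.
have h1 : `|f n (lpos x)| <= e / 2.
  apply: pos; first exact: lpos_ge0.
  by exists x => //; rewrite labs_id ?lpos_ge0 ?lpos_labs.
have h2 : `|f n (lpos (- x))| <= e / 2.
  apply: pos; first exact: lpos_ge0.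
  by exists x => //; rewrite labs_id ?lpos_ge0 ?lposN_labs.
by rewrite [x]lpos_subN linearB; move: h1 h2; rewrite !ler_norml; lra.
Qed.

Lemma d_DP_DW_compact : d_DP_property E ->
  forall (Y : completeNormedModType R) (T : {linear E -> Y}),
    weakly_compact_operator T -> DW_compact T.
Proof.
move=> dDP Y T wT; split=> [|A /dDP DPA]; first by have [] := wT.
exact: dunford_pettis_precompact.
Qed.

Lemma c0_DW_compact_d_DP :
  (forall T : {linear E -> c0 R}, weakly_compact_operator T -> DW_compact T) ->
  d_DP_property E.
Proof.
move=> DW A dA; apply/dunford_pettis_setP; split=> [|f f0 e e0].
  by have [] := dA.
have [T TE] := weakly_null_operator f0.
have [_ /(_ A dA) cTA] := DW T (weakly_null_operator_weakly_compact f0 TE).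
apply: filterS (c0_precompact_tail cTA e0) => n h x Ax.
by rewrite -TE; apply: h; exists x.
Qed.

End dDP.

Theorem theorem3p6 (R : realType) (E : banachLatticeType R) :
  [<-> d_DP_property E;
       dunford_pettis_property E /\
       (forall a b : E, dunford_pettis_set (order_interval a b));
       forall (Y : completeNormedModType R) (T : {linear E -> Y}),
         weakly_compact_operator T -> DW_compact T;
       forall T : {linear E -> c0 R},
         weakly_compact_operator T -> DW_compact T].
Proof.
tfae.
- exact: d_DP_dunford_pettis.
(* This implication passes through the (d)-DP property. *)
- by move=> [DP DPi]; apply: d_DP_DW_compact; exact: dunford_pettis_d_DP.
- by move=> h T; exact: h.
- exact: c0_DW_compact_d_DP.
Qed.
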